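(* The subset $\mathcal C_n:=\{m_{\mathfrak s\mathfrak t}:\lambda\in\mathrm{Par}^1_{l,n},\ \mathfrak s,\mathfrak t\in\mathrm{Std}(\lambda)\}$ of the generalized blob algebra $B_n$ spans $B_n$ over $F$.
   Context: **Combinatorics.** A one-column $l$-multipartition of $n$ is a tuple $\lambda=((1^{a_1}),\dots,(1^{a_l}))$ with integers $a_m\ge 0$, $\sum_m a_m=n$; its diagram is $[\lambda]=\{(r,1,m):1\le m\le l,\ 1\le r\le a_m\}$. $\mathrm{Par}^1_{l,n}$ is the set of all of them. Nodes are totally ordered by: $(r,1,m)\lhd(r',1,m')$ iff $r>r'$, or $r=r'$ and $m>m'$. A $\lambda$-tableau is a bijection $\mathfrak t:\{1,\dots,n\}\to[\lambda]$; it is standard if its entries increase from top to bottom in every component. $\mathrm{Tab}(\lambda)$, $\mathrm{Std}(\lambda)$: all, resp. standard, $\lambda$-tableaux. $\mathfrak t^\lambda$ is the $\lambda$-tableau with $\mathfrak t^\lambda(1)\rhd\cdots\rhd\mathfrak t^\lambda(n)$ (numbers filled in along rows). $S_n$ acts on the right on $\mathrm{Tab}(\lambda)$ by $\mathfrak t w=\mathfrak t\circ w$ (so $\mathfrak t s_k$, $s_k=(k,k+1)$, interchanges entries $k,k+1$), and $\mathfrak t^\lambda d(\mathfrak t)=\mathfrak t$ defines $d(\mathfrak t)\in S_n$. **Algebra.** Fix integers $e,l,n>1$, a field $F$ and a primitive $e$-th root of unity $q\in F\setminus\{1\}$; $I_e=\mathbb Z/e\mathbb Z$; $S_n$ acts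 on $I_e^n$ by permuting coordinates. Fix $\hat\kappa\in\mathbb Z^l$; $\kappa_m\in I_e$ is the image of $\hat\kappa_m$, also identified with its representative in $\{0,\dots,e-1\}$. $\hat\kappa$ is strongly adjacency-free: (i) $\hat\kappa_{m+1}-\hat\kappa_m\ge n$; (ii) $\kappa_i-\kappa_j\not\equiv 0,\pm1\bmod e$ for $i\ne j$; (iii) $\kappa_1\not\equiv\kappa_l+2\bmod e$; (iv) $\kappa_1<\dots<\kappa_l$. The generalized blob algebra $B_n$ is the unital associative $F$-algebra with generators $\psi_1,\dots,\psi_{n-1},y_1,\dots,y_n,e(\boldsymbol i)$ ($\boldsymbol i\in I_e^n$) and relations: $e(\boldsymbol i)e(\boldsymbol j)=\delta_{\boldsymbol i\boldsymbol j}e(\boldsymbol i)$; $\sum_{\boldsymbol i}e(\boldsymbol i)=1$; $e(\boldsymbol i)=0$ if $i_1\notin\{\kappa_1,\dots,\kappa_l\}$; $e(\boldsymbol i)=0$ if $i_1\in\{\kappa_1,\dots,\kappa_l\}$ and $i_2=i_1+1$; $y_1e(\boldsymbol i)=0$ if $i_1\in\{\kappa_1,\dots,\kappa_l\}$; $y_re(\boldsymbol i)=e(\boldsymbol i)y_r$; $\psi_re(\boldsymbol i)=e(s_r\cdot\boldsymbol i)\psi_r$; $y_ry_s=y_sy_r$; $\psi_ry_s=y_s\psi_r$ if $s\ne r,r+1$; $\psi_r\psi_s=\psi_s\psi_r$ if $|r-s|>1$; $\psi_ry_{r+1}e(\boldsymbol i)=(y_r\psi_r-\delta_{i_r,i_{r+1}})e(\boldsymbol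 i)$; $y_{r+1}\psi_re(\boldsymbol i)=(\psi_ry_r-\delta_{i_r,i_{r+1}})e(\boldsymbol i)$; $\psi_r^2e(\boldsymbol i)$ equals $0$ if $i_r=i_{r+1}$, $e(\boldsymbol i)$ if $i_r\ne i_{r+1},i_{r+1}\pm1$, $(y_{r+1}-y_r)e(\boldsymbol i)$ if $i_{r+1}=i_r+1$, $(y_r-y_{r+1})e(\boldsymbol i)$ if $i_{r+1}=i_r-1$; $\psi_r\psi_{r+1}\psi_re(\boldsymbol i)=(\psi_{r+1}\psi_r\psi_{r+1}+\alpha)e(\boldsymbol i)$ with $\alpha=-1$ if $i_{r+2}=i_r=i_{r+1}-1$, $\alpha=1$ if $i_{r+2}=i_r=i_{r+1}+1$, $\alpha=0$ otherwise. $*$ is the anti-involution of $B_n$ fixing all generators. **The elements $m_{\mathfrak s\mathfrak t}$.** The residue of $(r,1,m)$ is $\mathrm{res}=\kappa_m+1-r\in I_e$; $\boldsymbol i^\lambda=(\mathrm{res}(\mathfrak t^\lambda(1)),\dots,\mathrm{res}(\mathfrak t^\lambda(n)))$. For each $w\in S_n$ a reduced expression $w=s_{i_1}\cdots s_{i_N}$ is chosen once and for all and $\psi_w:=\psi_{i_1}\cdots\psi_{i_N}$. For $\mathfrak s,\mathfrak t\in\mathrm{Tab}(\lambda)$, $m_{\mathfrak s\mathfrak t}:=\psi_{d(\mathfrak s)}^*e(\boldsymbol i^\lambda)\psi_{d(\mathfrak t)}\in B_n$. *)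

(* Defs.v *)
From HB Require Import structures.
From mathcomp Require Import all_boot all_order all_fingroup all_algebra.
From mathcomp Require Import boolp.
From mathcomp Require Import finmap monalg.

Set Implicit Arguments.
Unset Strict Implicit.
Unset Printing Implicit Defensive.

Import Order.TTheory GRing.Theory Num.Theory.

Local Open Scope ring_scope.
Local Open Scope quotient_scope.

(** [alg_quot R] is the quotient of the [F]-algebra [A] by the two-sided ideal
    generated by all [u - v] with [R u v].  It may be zero, which is why it is
    a [pzRingType] and an [lmodType F] together with the compatibility lemmas
    [alg_quot_scalerAl] and [alg_quot_scalerAr] rather than an [algType F] (the
    latter requires [1 != 0]). *)

Section AlgQuotient.
Variables (F : fieldType) (A : algType F) (R : A -> A -> Prop).

Inductive two_sided_ideal : A -> Prop :=
| ideal0 : two_sided_ideal 0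
| idealD a u v b x of R u v & two_sided_ideal x :
    two_sided_ideal (a * (u - v) * b + x).

Definition ideal_pred : {pred A} := fun x => `[< two_sided_ideal x >].

Lemma two_sided_ideal_closed : zmod_closed ideal_pred.
Proof.
have idD x y : two_sided_ideal x -> two_sided_ideal y -> two_sided_ideal (x + y).
  by elim=> [|a u v b z uv _ IH] Iy; rewrite ?add0r // -addrA; constructor; auto.
split=> [|x y /asboolP Ix /asboolP Iy]; apply/asboolP; first by constructor.
apply: idD => //; elim: Iy => [|a u v b z uv _ IH]; first by rewrite oppr0; left.
by rewrite opprD -!mulNr; constructor.
Qed.

HB.instance Definition _ :=
  GRing.isZmodClosed.Build A ideal_pred two_sided_ideal_closed.

Lemma ideal_mulr x y : x \in ideal_pred -> x * y \in ideal_pred.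
Proof.
move=> /asboolP Ix; apply/asboolP; elim: Ix => [|a u v b z uv _ IH].
  by rewrite mul0r; left.
by rewrite mulrDl -!mulrA [_ * (_ * (_ * _))]mulrA; constructor.
Qed.

Lemma ideal_mull x y : x \in ideal_pred -> y * x \in ideal_pred.
Proof.
move=> /asboolP Ix; apply/asboolP; elim: Ix => [|a u v b z uv _ IH].
  by rewrite mulr0; left.
by rewrite mulrDr !mulrA; constructor.
Qed.

Lemma ideal_rel u v : R u v -> u - v \in ideal_pred.
Proof.
move=> uv; apply/asboolP; rewrite -[u - v]mul1r -[1 * _]mulr1 -[_ * 1]addr0.
by constructor => //; left.
Qed.

Definition alg_quot : Type := {ideal_quot ideal_pred}.
HB.instance Definition _ := GRing.Zmodule.on alg_quot.

Definition alg_quot_pi (x : A) : alg_quot := \pi_{ideal_quot ideal_pred} x.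
Definition alg_quot_repr (p : alg_quot) : A := generic_quotient.repr (p : {ideal_quot ideal_pred}).
Local Notation pi := alg_quot_pi.
Local Notation rp := alg_quot_repr.

Lemma alg_quot_reprK : cancel rp pi.
Proof. exact: reprK. Qed.

Lemma alg_quot_eqE x y : (pi x == pi y) = (x - y \in ideal_pred).
Proof. by rewrite Quotient.idealrBE. Qed.

Lemma alg_quot_reprB x : rp (pi x) - x \in ideal_pred.
Proof. by rewrite -alg_quot_eqE alg_quot_reprK. Qed.

Lemma alg_quot_rel u v : R u v -> pi u = pi v.
Proof. by move=> uv; apply/eqP; rewrite alg_quot_eqE ideal_rel. Qed.

Lemma alg_quot_pi0 : pi 0 = 0.
Proof. by rewrite /pi piE. Qed.

Lemma alg_quot_piD x y : pi (x + y) = pi x + pi y.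
Proof. by rewrite /pi piE. Qed.

Definition alg_quot_mul (p q : alg_quot) : alg_quot := pi (rp p * rp q).

Lemma alg_quot_mulE x y : alg_quot_mul (pi x) (pi y) = pi (x * y).
Proof.
apply/eqP; rewrite alg_quot_eqE.
have -> : rp (pi x) * rp (pi y) - x * y =
  (rp (pi x) - x) * rp (pi y) + x * (rp (pi y) - y).
  by rewrite mulrBl mulrBr addrA subrK.
by apply: rpredD; [apply: ideal_mulr | apply: ideal_mull]; exact: alg_quot_reprB.
Qed.

Definition alg_quot_scale (c : F) (p : alg_quot) : alg_quot := pi (c *: rp p).

Lemma alg_quot_scaleE c x : alg_quot_scale c (pi x) = pi (c *: x).
Proof.
apply/eqP; rewrite alg_quot_eqE -scalerBr -[X in _ *: X]mul1r scalerAl.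
by apply: ideal_mull; exact: alg_quot_reprB.
Qed.

Lemma alg_quot_mulA : associative alg_quot_mul.
Proof.
move=> p q r; rewrite -[p]alg_quot_reprK -[q]alg_quot_reprK.
by rewrite -[r]alg_quot_reprK !alg_quot_mulE mulrA.
Qed.

Lemma alg_quot_mul1 : left_id (pi 1) alg_quot_mul.
Proof. by move=> p; rewrite -[p]alg_quot_reprK alg_quot_mulE mul1r. Qed.

Lemma alg_quot_mulr1 : right_id (pi 1) alg_quot_mul.
Proof. by move=> p; rewrite -[p]alg_quot_reprK alg_quot_mulE mulr1. Qed.

Lemma alg_quot_mulDl : left_distributive alg_quot_mul +%R.
Proof.
move=> p q r; rewrite -[p]alg_quot_reprK -[q]alg_quot_reprK.
rewrite -[r]alg_quot_reprK -alg_quot_piD !alg_quot_mulE.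
by rewrite -alg_quot_piD mulrDl.
Qed.

Lemma alg_quot_mulDr : right_distributive alg_quot_mul +%R.
Proof.
move=> p q r; rewrite -[p]alg_quot_reprK -[q]alg_quot_reprK.
rewrite -[r]alg_quot_reprK -alg_quot_piD !alg_quot_mulE.
by rewrite -alg_quot_piD mulrDr.
Qed.

HB.instance Definition _ := GRing.Zmodule_isPzRing.Build alg_quot
  alg_quot_mulA alg_quot_mul1 alg_quot_mulr1 alg_quot_mulDl alg_quot_mulDr.

Lemma alg_quot_scalerA a b p :
  alg_quot_scale a (alg_quot_scale b p) = alg_quot_scale (a * b) p.
Proof. by rewrite -[p]alg_quot_reprK !alg_quot_scaleE scalerA. Qed.

Lemma alg_quot_scale1r : left_id 1 alg_quot_scale.
Proof. by move=> p; rewrite -[p]alg_quot_reprK alg_quot_scaleE scale1r. Qed.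

Lemma alg_quot_scalerDr : right_distributive alg_quot_scale +%R.
Proof.
move=> c p q; rewrite -[p]alg_quot_reprK -[q]alg_quot_reprK -alg_quot_piD.
by rewrite !alg_quot_scaleE -alg_quot_piD scalerDr.
Qed.

Lemma alg_quot_scalerDl p :
  {morph alg_quot_scale^~ p : a b / a + b}.
Proof.
move=> a b /=; rewrite -[p]alg_quot_reprK !alg_quot_scaleE -alg_quot_piD.
by rewrite scalerDl.
Qed.

HB.instance Definition _ := GRing.Zmodule_isLmodule.Build F alg_quot
  alg_quot_scalerA alg_quot_scale1r alg_quot_scalerDr alg_quot_scalerDl.

Lemma alg_quot_pi_is_monoid_morphism : monoid_morphism pi.
Proof. split=> [|x y]; [exact: erefl | exact/esym/alg_quot_mulE]. Qed.

Lemma alg_quot_pi_is_linear : linear pi.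
Proof. by move=> c x y; rewrite alg_quot_piD -alg_quot_scaleE. Qed.

HB.instance Definition _ :=
  GRing.isLinear.Build F A alg_quot _ pi alg_quot_pi_is_linear.
HB.instance Definition _ :=
  GRing.isMonoidMorphism.Build A alg_quot pi alg_quot_pi_is_monoid_morphism.

Lemma alg_quot_scalerAl (c : F) (p q : alg_quot) : c *: (p * q) = (c *: p) * q.
Proof.
rewrite -[p]alg_quot_reprK -[q]alg_quot_reprK -rmorphM -!linearZ -rmorphM /=.
by rewrite scalerAl.
Qed.

Lemma alg_quot_scalerAr (c : F) (p q : alg_quot) : c *: (p * q) = p * (c *: q).
Proof.
rewrite -[p]alg_quot_reprK -[q]alg_quot_reprK -rmorphM -!linearZ -rmorphM /=.
by rewrite scalerAr.
Qed.

Section Star.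
Variable star : {linear A -> A}.

Definition alg_quot_star (p : alg_quot) : alg_quot := pi (star (rp p)).

Hypothesis starM : forall a b, star (a * b) = star b * star a.
Hypothesis star_rel : forall u v, R u v -> pi (star u) = pi (star v).

Lemma alg_quot_starE x : alg_quot_star (pi x) = pi (star x).
Proof.
apply/eqP; rewrite alg_quot_eqE -linearB /=.
have /asboolP : rp (pi x) - x \in ideal_pred by exact: alg_quot_reprB.
elim=> [|a u v b z uv _ IH]; first by rewrite linear0 rpred0.
rewrite linearD rpredD //= !starM ideal_mull // ideal_mulr //.
by rewrite linearB -alg_quot_eqE; apply/eqP/star_rel.
Qed.

Lemma alg_quot_starM p q :
  alg_quot_star (p * q) = alg_quot_star q * alg_quot_star p.
Proof.
rewrite -[p]alg_quot_reprK -[q]alg_quot_reprK -rmorphM !alg_quot_starE.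
by rewrite starM rmorphM.
Qed.

Lemma alg_quot_star_is_linear : linear alg_quot_star.
Proof.
move=> c p q; rewrite -[p]alg_quot_reprK -[q]alg_quot_reprK.
by rewrite -linearP !alg_quot_starE !linearP.
Qed.

Lemma alg_quot_starK : involutive star -> involutive alg_quot_star.
Proof.
by move=> starK p; rewrite -[p]alg_quot_reprK !alg_quot_starE starK.
Qed.

End Star.
End AlgQuotient.

Section FreeAlgebra.
Variables (F : fieldType) (X : choiceType).
Local Notation A := {malg F[{fmonom X}]}.
Implicit Types (g h : A) (w : {fmonom X}).

Lemma free_scalerAr (c : F) (x y : A) : c *: (x * y) = x * (c *: y).
Proof.
have comm (z : A) : z * c%:MP = c *: z.
  rewrite malgM_def fgmulgU malgZ_def /fgscale; apply: eq_bigr => k _.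
  by rewrite mulm1 mulrC.
by rewrite -(comm (x * y)) -mulrA comm.
Qed.

Definition rev_word (w : {fmonom X}) : {fmonom X} := FMonom (rev w).

Definition free_star (g : A) : A := \sum_(w <- msupp g) g@_w *: << rev_word w >>.

Lemma free_starE (d : {fset {fmonom X}}) g : (msupp g `<=` d)%fset ->
  free_star g = \sum_(w <- d) g@_w *: << rev_word w >>.
Proof.
move=> le; rewrite /free_star [LHS](big_fset_incl _ le) //= => x xd.
by move/mcoeff_outdom->; rewrite scale0r.
Qed.

Lemma free_starD g h : free_star (g + h) = free_star g + free_star h.
Proof.
pose d := (msupp g `|` msupp h)%fset.
rewrite (@free_starE d (g + h)) ?msuppD_le // (@free_starE d g) ?fsubsetUl //.
rewrite (@free_starE d h) ?fsubsetUr // -big_split; apply: eq_bigr => w _ /=.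
by rewrite mcoeffD scalerDl.
Qed.

Lemma free_starZ c g : free_star (c *: g) = c *: free_star g.
Proof.
rewrite (free_starE (msuppZ_le c g)) /free_star scaler_sumr.
by apply: eq_bigr => w _; rewrite mcoeffZ scalerA.
Qed.

Lemma free_star0 : free_star 0 = 0.
Proof. by rewrite -[X in free_star X](scale0r 0) free_starZ scale0r. Qed.

Lemma free_starU w : free_star << w >> = << rev_word w >>.
Proof.
by rewrite (free_starE msuppU_le) big_seq_fset1 mcoeffUU scale1r.
Qed.

Lemma free_star1 : free_star 1 = 1.
Proof.
rewrite [LHS]free_starU; congr << _ >>.
by apply/eqP; rewrite fmP /= fm1.
Qed.

Lemma malgU1Z (g : A) : g = \sum_(w <- msupp g) g@_w *: << w >>.
Proof.
rewrite {1}[g]monalgE; apply: eq_bigr => w _.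
apply/malgP=> k; rewrite mcoeffZ !mcoeffU mulr_natr.
exact: erefl.
Qed.

Lemma malgUM w w' : << w >> * << w' >> = << (mmul w w') >> :> A.
Proof. by rewrite malgM_def fgmulUU mulr1. Qed.

Lemma free_starUM w w' : free_star (<< w >> * << w' >>) =
  free_star << w' >> * free_star << w >>.
Proof.
rewrite !free_starU !malgUM free_starU; congr << _ >>.
by apply/eqP; rewrite fmP /= !fmM /= rev_cat.
Qed.

Lemma free_starM g h : free_star (g * h) = free_star h * free_star g.
Proof.
have starS (I : choiceType) (s : {fset I}) (c : I -> F) (f : I -> A) :
    free_star (\sum_(i <- s) c i *: f i) = \sum_(i <- s) c i *: free_star (f i).
  by rewrite (big_morph free_star free_starD free_star0); apply: eq_bigr => i _;
       rewrite free_starZ.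
transitivity (free_star (\sum_(w <- msupp g) g@_w *: (<< w >> * h))).
  congr free_star; rewrite [in LHS](malgU1Z g) mulr_suml.
  by apply: eq_bigr => w _; exact/esym/scalerAl.
rewrite starS /= [free_star g]/free_star mulr_sumr; apply: eq_bigr => w _.
transitivity (g@_w *: (free_star h * << rev_word w >>)); last exact: free_scalerAr.
congr (_ *: _).
transitivity (free_star (\sum_(w' <- msupp h) h@_w' *: (<< w >> * << w' >>))).
  congr free_star; rewrite [in LHS](malgU1Z h) mulr_sumr.
  by apply: eq_bigr => w' _; exact/esym/free_scalerAr.
rewrite starS /= [free_star h]/free_star mulr_suml; apply: eq_bigr => w' _.
by rewrite free_starUM !free_starU; exact: scalerAl.
Qed.

Lemma free_starK : involutive free_star.
Proof.
move=> g; rewrite {2}(malgU1Z g) {2}/free_star.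
rewrite (big_morph free_star free_starD free_star0); apply: eq_bigr => w _.
rewrite free_starZ free_starU; congr (_ *: << _ >>).
by apply/eqP; rewrite fmP /= revK.
Qed.

Lemma free_star_is_linear : linear free_star.
Proof. by move=> c g h; rewrite free_starD free_starZ. Qed.

Definition free_alg : Type := A.
HB.instance Definition _ := GRing.Lalgebra.on free_alg.
HB.instance Definition _ :=
  GRing.Lalgebra_isAlgebra.Build F free_alg free_scalerAr.

Definition free_gen (x : X) : free_alg := << fmu x >>.

Definition free_alg_star : free_alg -> free_alg := free_star.
HB.instance Definition _ :=
  GRing.isLinear.Build F free_alg free_alg _ free_alg_star free_star_is_linear.

Lemma free_alg_star1 : free_alg_star 1 = 1.
Proof. exact: free_star1. Qed.

Lemma free_alg_starM (a b : free_alg) :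
  free_alg_star (a * b) = free_alg_star b * free_alg_star a.
Proof. exact: free_starM. Qed.

Lemma free_alg_starK : involutive free_alg_star.
Proof. exact: free_starK. Qed.

Lemma free_alg_star_gen x : free_alg_star (free_gen x) = free_gen x.
Proof.
rewrite [LHS]free_starU /rev_word /free_gen; congr << _ >>.
by apply/eqP; rewrite fmP /= fmU.
Qed.

End FreeAlgebra.

(** A presentation of the generalized blob algebra.  Positions
    [1, ..., n] are the elements of ['I_n] and [1, ..., n - 1] those of
    ['I_n.-1], both shifted by one; [fst_pos r] and [snd_pos r] are the
    positions [r] and [r + 1]. *)

Section Positions.
Variable n : nat.

Definition fst_pos (r : 'I_n.-1) : 'I_n := widen_ord (leq_pred n) r.

Lemma snd_pos_subproof (r : 'I_n.-1) : (r.+1 < n)%N.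
Proof. by case: n r => [|m] r; [case: r | rewrite ltnS]. Qed.

Definition snd_pos (r : 'I_n.-1) : 'I_n := Ordinal (snd_pos_subproof r).

Definition transp (r : 'I_n.-1) : 'S_n := tperm (fst_pos r) (snd_pos r).

Definition swap_seq (e : nat) (r : 'I_n.-1) (i : {ffun 'I_n -> 'Z_e}) :
  {ffun 'I_n -> 'Z_e} := [ffun k => i (transp r k)].

End Positions.


Section BlobRelations.
Variables (F : fieldType) (e l n : nat) (kappa : 'I_l -> 'Z_e).
Local Notation residues := {ffun 'I_n -> 'Z_e}.

(** The up and down cases of the quadratic relation, and the two nonzero cases
    of [braid_coef], overlap only when [2 = 0] in ['Z_e]; for [1 < l] a
    strongly adjacency-free multicharge forces [4 <= e]. *)

Definition braid_coef (a b c : 'Z_e) : F :=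
  if (c == a) && (a == b - 1) then -1
  else if (c == a) && (a == b + 1) then 1 else 0.

Variables (A : algType F).
Variables (psi : 'I_n.-1 -> A) (y : 'I_n -> A) (idem : residues -> A).

Inductive blob_rel : A -> A -> Prop :=
| rel_orth (i j : residues) :
    blob_rel (idem i * idem j) ((i == j)%:R *: idem i)
| rel_sum1 : blob_rel (\sum_i idem i) 1
| rel_fst (i : residues) (p1 : 'I_n) of p1 = 0%N :> nat
    & (forall m, i p1 != kappa m) : blob_rel (idem i) 0
| rel_snd (i : residues) (p1 p2 : 'I_n) m of p1 = 0%N :> nat & p2 = 1%N :> nat
    & i p1 = kappa m & i p2 = i p1 + 1 : blob_rel (idem i) 0
| rel_y1 (i : residues) (p1 : 'I_n) m of p1 = 0%N :> nat & i p1 = kappa m :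
    blob_rel (y p1 * idem i) 0
| rel_ye (i : residues) r : blob_rel (y r * idem i) (idem i * y r)
| rel_psie (i : residues) r :
    blob_rel (psi r * idem i) (idem (swap_seq r i) * psi r)
| rel_yy r s : blob_rel (y r * y s) (y s * y r)
| rel_psiy r s of s != fst_pos r & s != snd_pos r :
    blob_rel (psi r * y s) (y s * psi r)
| rel_psipsi (r s : 'I_n.-1) of (r.+1 < s)%N || (s.+1 < r)%N :
    blob_rel (psi r * psi s) (psi s * psi r)
| rel_psiyS (i : residues) r :
    blob_rel (psi r * y (snd_pos r) * idem i)
      ((y (fst_pos r) * psi r - (i (fst_pos r) == i (snd_pos r))%:R) * idem i)
| rel_ySpsi (i : residues) r :
    blob_rel (y (snd_pos r) * psi r * idem i)
      ((psi r * y (fst_pos r) - (i (fst_pos r) == i (snd_pos r))%:R) * idem i)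
| rel_sqr_eq (i : residues) r of i (fst_pos r) = i (snd_pos r) :
    blob_rel (psi r ^+ 2 * idem i) 0
| rel_sqr_far (i : residues) r of i (fst_pos r) != i (snd_pos r)
    & i (fst_pos r) != i (snd_pos r) + 1 & i (fst_pos r) != i (snd_pos r) - 1 :
    blob_rel (psi r ^+ 2 * idem i) (idem i)
| rel_sqr_up (i : residues) r of i (snd_pos r) = i (fst_pos r) + 1 :
    blob_rel (psi r ^+ 2 * idem i) ((y (snd_pos r) - y (fst_pos r)) * idem i)
| rel_sqr_down (i : residues) r of i (snd_pos r) = i (fst_pos r) - 1 :
    blob_rel (psi r ^+ 2 * idem i) ((y (fst_pos r) - y (snd_pos r)) * idem i)
| rel_braid (i : residues) (r s : 'I_n.-1) of s = r.+1 :> nat :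
    blob_rel (psi r * psi s * psi r * idem i)
      ((psi s * psi r * psi s
        + (braid_coef (i (fst_pos r)) (i (snd_pos r)) (i (snd_pos s)))%:A)
       * idem i).

Local Notation pi := (alg_quot_pi blob_rel).
Local Notation qpsi r := (pi (psi r)).
Local Notation qy r := (pi (y r)).
Local Notation qe i := (pi (idem i)).

Lemma swap_seqK r : involutive (@swap_seq n e r).
Proof. by move=> i; apply/ffunP=> k; rewrite !ffunE /transp tpermK. Qed.

Lemma swap_seq_id r (i : residues) :
  i (fst_pos r) = i (snd_pos r) -> swap_seq r i = i.
Proof.
by move=> ii; apply/ffunP=> k; rewrite ffunE /transp; case: tpermP => // ->.
Qed.

Lemma swap_seq_fst r (i : residues) : swap_seq r i (fst_pos r) = i (snd_pos r).
Proof. by rewrite ffunE /transp tpermL. Qed.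

Lemma swap_seq_snd r (i : residues) : swap_seq r i (snd_pos r) = i (fst_pos r).
Proof. by rewrite ffunE /transp tpermR. Qed.

Lemma tperm_braid (T : finType) (a b c k : T) : a != b -> a != c -> b != c ->
  tperm a b (tperm b c (tperm a b k)) = tperm a c k /\
  tperm b c (tperm a b (tperm b c k)) = tperm a c k.
Proof.
move=> ab ac bc; have E := tpermJ b c (tperm a b).
have E' := tpermJ a b (tperm b c).
rewrite tpermR (@tpermD _ a b c) // in E.
rewrite tpermL (@tpermD _ b c a) 1?eq_sym // in E'.
by rewrite -{1}E -{1}E' /conjg !tpermV !permM.
Qed.

Lemma pos_braid (r s : 'I_n.-1) : s = r.+1 :> nat ->
  [/\ fst_pos s = snd_pos r, fst_pos r != snd_pos r, fst_pos r != snd_pos s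
    & snd_pos r != snd_pos s].
Proof.
move=> rs; split; first exact: val_inj.
- by rewrite -val_eqE /= neq_ltn ltnSn.
- by rewrite -val_eqE /= rs neq_ltn ltnS leqnSn.
by rewrite -val_eqE /= rs neq_ltn ltnSn.
Qed.

Lemma swap_seq_braid (r s : 'I_n.-1) (i : residues) : s = r.+1 :> nat ->
  swap_seq r (swap_seq s (swap_seq r i)) =
    [ffun k => i (tperm (fst_pos r) (snd_pos s) k)] /\
  swap_seq s (swap_seq r (swap_seq s i)) =
    [ffun k => i (tperm (fst_pos r) (snd_pos s) k)].
Proof.
move=> /pos_braid[fs ab ac bc].
by split; apply/ffunP=> k; rewrite !ffunE /transp fs;
  have [E E'] := tperm_braid k ab ac bc; rewrite ?E ?E'.
Qed.

Lemma qpsi_idem r i : qpsi r * qe i = qe (swap_seq r i) * qpsi r.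
Proof. by rewrite -!rmorphM; apply/alg_quot_rel/rel_psie. Qed.

Lemma qidem_psi r i : qe i * qpsi r = qpsi r * qe (swap_seq r i).
Proof. by rewrite qpsi_idem swap_seqK. Qed.

Lemma qy_idem r i : qy r * qe i = qe i * qy r.
Proof. by rewrite -!rmorphM; apply/alg_quot_rel/rel_ye. Qed.

Lemma qsqr_psi_idem r i : qe i * (qpsi r * qpsi r) = qpsi r ^+ 2 * qe i.
Proof. by rewrite mulrA qidem_psi -mulrA qidem_psi swap_seqK mulrA expr2. Qed.

Lemma qbraid_coef (r s : 'I_n.-1) (i : residues) : s = r.+1 :> nat ->
  let j : residues := [ffun k => i (tperm (fst_pos r) (snd_pos s) k)] in
  braid_coef (j (fst_pos r)) (j (snd_pos r)) (j (snd_pos s)) *: qe j =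
  braid_coef (i (fst_pos r)) (i (snd_pos r)) (i (snd_pos s)) *: qe i.
Proof.
move=> /pos_braid[fs ab ac bc] j.
rewrite {1}/j !ffunE tpermL tpermR tpermD //; last by rewrite eq_sym.
have [ii|/negPf ii] := eqVneq (i (fst_pos r)) (i (snd_pos s)).
  rewrite ii; congr (_ *: pi (idem _)); apply/ffunP=> k.
  by rewrite ffunE; case: tpermP => // ->.
have ii' : (i (snd_pos s) == i (fst_pos r)) = false by rewrite eq_sym.
by rewrite /braid_coef ii ii' /= !scale0r.
Qed.

Variable star : {linear A -> A}.
Hypothesis star1 : star 1 = 1.
Hypothesis starM : forall a b, star (a * b) = star b * star a.
Hypothesis star_psi : forall r, star (psi r) = psi r.
Hypothesis star_y : forall r, star (y r) = y r.
Hypothesis star_idem : forall i, star (idem i) = idem i.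

Lemma blob_star_rel u v : blob_rel u v -> pi (star u) = pi (star v).
Proof.
have sE := (starM, star_psi, star_y, star_idem).
case.
- move=> i j; rewrite linearZ !sE; apply: alg_quot_rel.
  have [->|ij] := eqVneq i j; first by have := rel_orth j j; rewrite eqxx.
  by have := rel_orth j i; rewrite eq_sym (negPf ij) /= !mulr0n !scale0r.
- rewrite linear_sum star1 /= (eq_bigr idem) => [|i _]; last exact: star_idem.
  exact/alg_quot_rel/rel_sum1.
- by move=> i p p0 ip; rewrite sE linear0; apply/alg_quot_rel/(rel_fst p0 ip).
- move=> i p p' m p0 p1 ip ip'; rewrite sE linear0.
  exact/alg_quot_rel/(rel_snd p0 p1 ip ip').
- move=> i p m p0 ip; rewrite !sE linear0 rmorphM -qy_idem -rmorphM.
  exact/alg_quot_rel/(rel_y1 p0 ip).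
- by move=> i r; rewrite !sE; apply/esym/alg_quot_rel/rel_ye.
- by move=> i r; rewrite !sE !rmorphM; apply: qidem_psi.
- by move=> r s; rewrite !sE; apply/esym/alg_quot_rel/rel_yy.
- by move=> r s s1 s2; rewrite !sE; apply/esym/alg_quot_rel/rel_psiy.
- by move=> r s rs; rewrite !sE; apply/esym/alg_quot_rel/rel_psipsi.
- move=> i r; have := alg_quot_rel (rel_ySpsi (swap_seq r i) r).
  rewrite swap_seq_fst swap_seq_snd [in X in X -> _]eq_sym.
  rewrite !sE linearB /= !sE.
  rewrite !(rmorphM, rmorphB) /= => E.
  have -> : qe i * (qy (snd_pos r) * qpsi r) =
            qy (snd_pos r) * qpsi r * qe (swap_seq r i).
    by rewrite mulrA -qy_idem -mulrA qidem_psi mulrA.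
  rewrite {}E mulrBl mulrBr.
  have -> : qpsi r * qy (fst_pos r) * qe (swap_seq r i) =
            qe i * (qpsi r * qy (fst_pos r)).
    by rewrite -mulrA qy_idem mulrA -qidem_psi mulrA.
  congr (_ - _).
  case: eqP => [ii|_].
    by rewrite (swap_seq_id ii) star1 rmorph1 mulr1 mul1r.
  by rewrite /= mulr0n !linear0 mul0r mulr0.
- move=> i r; have := alg_quot_rel (rel_psiyS (swap_seq r i) r).
  rewrite swap_seq_fst swap_seq_snd [in X in X -> _]eq_sym.
  rewrite !sE linearB /= !sE.
  rewrite !(rmorphM, rmorphB) /= => E.
  have -> : qe i * (qpsi r * qy (snd_pos r)) =
            qpsi r * qy (snd_pos r) * qe (swap_seq r i).
    by rewrite mulrA qidem_psi -mulrA -qy_idem mulrA.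
  rewrite {}E mulrBl mulrBr.
  have -> : qy (fst_pos r) * qpsi r * qe (swap_seq r i) =
            qe i * (qy (fst_pos r) * qpsi r).
    by rewrite -mulrA -qidem_psi mulrA qy_idem mulrA.
  congr (_ - _).
  case: eqP => [ii|_].
    by rewrite (swap_seq_id ii) star1 rmorph1 mulr1 mul1r.
  by rewrite /= mulr0n !linear0 mul0r mulr0.
- move=> i r ii; rewrite expr2 !sE linear0 !rmorphM qsqr_psi_idem -rmorphXn.
  by rewrite -rmorphM; apply/alg_quot_rel/rel_sqr_eq.
- move=> i r i0 i1 i2; rewrite expr2 !sE !rmorphM qsqr_psi_idem -rmorphXn.
  by rewrite -rmorphM; apply/alg_quot_rel/rel_sqr_far.
- move=> i r ii; rewrite expr2 !sE linearB /= !sE !rmorphM qsqr_psi_idem.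
  rewrite rmorphB mulrBr -!qy_idem -mulrBl -rmorphB -rmorphXn -!rmorphM.
  exact/alg_quot_rel/rel_sqr_up.
- move=> i r ii; rewrite expr2 !sE linearB /= !sE !rmorphM qsqr_psi_idem.
  rewrite rmorphB mulrBr -!qy_idem -mulrBl -rmorphB -rmorphXn -!rmorphM.
  exact/alg_quot_rel/rel_sqr_down.
move=> i r s rs; set c := braid_coef _ _ _.
have [E1 E2] := swap_seq_braid i rs; set j : residues := [ffun=> _] in E1 E2.
have := alg_quot_rel (rel_braid j rs); set c' := braid_coef _ _ _ => E.
have cc : c' *: qe j = c *: qe i by exact: qbraid_coef.
rewrite !sE linearD /= !sE linearZ /= star1 mulrDr -scalerAr mulr1.
rewrite linearD linearZ /= -cc.
have mv x z t : qe i * (qpsi x * (qpsi z * qpsi t)) =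
    qpsi x * qpsi z * qpsi t * qe (swap_seq t (swap_seq z (swap_seq x i))).
  by rewrite mulrA qidem_psi -mulrA mulrA -!mulrA; congr (_ * _);
     rewrite mulrA qidem_psi -mulrA qidem_psi.
rewrite !rmorphM /= !mv E1 E2; move: E.
by rewrite mulrDl mulr_algl linearD linearZ !rmorphM.
Qed.

End BlobRelations.

Definition blob_gen (e n : nat) : choiceType :=
  ('I_n.-1 + 'I_n + {ffun 'I_n -> 'Z_e})%type.

Section Blob.
Variables (F : fieldType) (e l n : nat) (kappa : 'I_l -> 'Z_e).
Local Notation A := (free_alg F (blob_gen e n)).

Definition free_psi (r : 'I_n.-1) : A :=
  free_gen F (inl (inl r) : blob_gen e n).
Definition free_y (r : 'I_n) : A :=
  free_gen F (inl (inr r) : blob_gen e n).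
Definition free_idem (i : {ffun 'I_n -> 'Z_e}) : A :=
  free_gen F (inr i : blob_gen e n).

Definition blob_relation : A -> A -> Prop :=
  @blob_rel F e l n kappa A free_psi free_y free_idem.

Definition blob : Type := alg_quot blob_relation.
HB.instance Definition _ := GRing.PzRing.on blob.
HB.instance Definition _ := GRing.Lmodule.on blob.

Definition blob_psi (r : 'I_n.-1) : blob := alg_quot_pi blob_relation (free_psi r).
Definition blob_y (r : 'I_n) : blob := alg_quot_pi blob_relation (free_y r).
Definition blob_idem (i : {ffun 'I_n -> 'Z_e}) : blob :=
  alg_quot_pi blob_relation (free_idem i).

Lemma free_alg_star_rel u v : blob_relation u v ->
  alg_quot_pi blob_relation (free_alg_star u) = alg_quot_pi blob_relation (free_alg_star v).
Proof.
apply: blob_star_rel => [|a b|r|r|i].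
- exact: free_alg_star1.
- exact: free_alg_starM.
- exact: free_alg_star_gen.
- exact: free_alg_star_gen.
exact: free_alg_star_gen.
Qed.

Definition blob_star : blob -> blob :=
  @alg_quot_star F A blob_relation (@free_alg_star F (blob_gen e n)).

Lemma blob_star_is_linear : linear blob_star.
Proof. exact: (alg_quot_star_is_linear (@free_alg_starM F _) free_alg_star_rel). Qed.

Lemma blob_starM (a b : blob) : blob_star (a * b) = blob_star b * blob_star a.
Proof. exact: (alg_quot_starM (@free_alg_starM F _) free_alg_star_rel). Qed.

Lemma blob_starK : involutive blob_star.
Proof.
exact: (alg_quot_starK (@free_alg_starM F _) free_alg_star_rel (@free_alg_starK F _)).
Qed.

Lemma blob_star_gen (x : blob_gen e n) :
  blob_star (alg_quot_pi blob_relation (free_gen F x)) =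
  alg_quot_pi blob_relation (free_gen F x).
Proof.
rewrite /blob_star (alg_quot_starE (@free_alg_starM F _) free_alg_star_rel).
by congr alg_quot_pi; exact: free_alg_star_gen.
Qed.

Lemma blob_star_psi r : blob_star (blob_psi r) = blob_psi r.
Proof. exact: blob_star_gen. Qed.

Lemma blob_star_y r : blob_star (blob_y r) = blob_y r.
Proof. exact: blob_star_gen. Qed.

Lemma blob_star_idem i : blob_star (blob_idem i) = blob_idem i.
Proof. exact: blob_star_gen. Qed.

End Blob.

(** One-column [l]-multipartitions of [n].  The node [(r, 1, m)] of the
    diagram is the dependent pair of the component [m : 'I_l] and the row
    [r - 1 : 'I_(lam m)]. *)

Record par1 (l n : nat) := Par1 {
  height :> 'I_l -> nat;
  height_sum : (\sum_(m < l) height m)%N = n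
}.

Section Tableaux.
Variables (l n : nat) (lam : par1 l n).

Definition node : finType := {m : 'I_l & 'I_(lam m)}.

Definition node_comp (x : node) : 'I_l := tag x.
Definition node_row (x : node) : nat := (tagged x).+1.

(** [node_lt x y] is the strict order in which [x] precedes [y]: rows further
    down, and within a row components further right, are smaller. *)
Definition node_lt (x y : node) : bool :=
  (node_row y < node_row x)%N
  || (node_row x == node_row y) && (node_comp y < node_comp x)%N.

Record tableau := Tableau {
  tab_fun :> 'I_n -> node;
  tab_bij : bijective tab_fun
}.

Definition standard (t : tableau) : Prop :=
  forall j k, node_comp (t j) = node_comp (t k) ->
    (node_row (t j) < node_row (t k))%N -> (j < k)%N.

Definition node_ge (x y : node) : bool := (x == y) || node_lt y x.

Definition nodes : seq node := sort node_ge (enum node).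

Lemma card_node : #|node| = n.
Proof.
rewrite card_tagged sumnE big_map big_enum -[RHS](height_sum lam).
by apply: eq_bigr => m _; rewrite card_ord.
Qed.

Lemma size_nodes : size nodes == n.
Proof. by rewrite size_sort -cardE card_node. Qed.

Lemma nodes_uniq : uniq nodes.
Proof. by rewrite sort_uniq enum_uniq. Qed.

Lemma mem_nodes x : x \in nodes.
Proof. by rewrite mem_sort mem_enum. Qed.

Lemma initial_bij : bijective (tnth (Tuple size_nodes)).
Proof.
apply: inj_card_bij; last by rewrite card_node card_ord.
exact/tuple_uniqP/nodes_uniq.
Qed.

(** The tableau [t^lambda], see [initialP]. *)
Definition initial : tableau := Tableau initial_bij.

Lemma node_inj x y : node_row x = node_row y -> node_comp x = node_comp y -> x = y.
Proof.
case: x y => [m r] [m' r'] /= rr mm; rewrite /node_comp /node_row /= in rr mm.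
move: r' rr; rewrite -mm => r' [/val_inj ->] //.
Qed.

Lemma initialP (j k : 'I_n) : (j < k)%N -> node_lt (initial k) (initial j).
Proof.
have tot : total node_ge.
  move=> x y; rewrite /node_ge /node_lt; case: ltngtP; rewrite ?orbT //= => rr.
  case: ltngtP; rewrite ?orbT //= => mm.
  by rewrite (node_inj rr (val_inj mm)) eqxx.
have tr : transitive node_ge.
  move=> x y z; rewrite /node_ge => /orP[/eqP-> //|yx] /orP[/eqP<-|xz].
    by rewrite yx orbT.
  apply/orP; right; move: yx xz; rewrite /node_lt.
  move=> /orP[r1|/andP[/eqP r1 m1]] /orP[r2|/andP[/eqP r2 m2]].
  - by rewrite (ltn_trans r1 r2).
  - by rewrite r2 r1.
  - by rewrite -r1 r2.
  by rewrite r2 r1 eqxx (ltn_trans m1 m2) orbT.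
move=> jk; have := sort_sorted tot (enum node); rewrite -/nodes => srt.
have [x0 E] : exists x0, forall i, initial i = nth x0 nodes i.
  by exists (initial j) => i; exact: tnth_nth.
have ge_jk : node_ge (initial j) (initial k).
  rewrite !E; apply: (sorted_leq_nth tr _ _ srt) => //; last exact: ltnW.
  - by move=> x; rewrite /node_ge eqxx.
  - by rewrite inE (eqP size_nodes).
  by rewrite inE (eqP size_nodes).
case/orP: ge_jk => // /eqP/(bij_inj initial_bij) jk'.
by rewrite jk' ltnn in jk.
Qed.

Lemma index_node_subproof (t : tableau) (k : 'I_n) : (index (t k) nodes < n)%N.
Proof. by rewrite -[X in (_ < X)%N](eqP size_nodes) index_mem mem_nodes. Qed.

Lemma dperm_inj (t : tableau) :
  injective (fun k => Ordinal (index_node_subproof t k)).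
Proof.
move=> j k [/(congr1 (nth (t j) nodes))]; rewrite !nth_index ?mem_nodes //.
exact: (bij_inj (tab_bij t)).
Qed.

(** The permutation [d(t)], see [dpermP]. *)
Definition dperm (t : tableau) : 'S_n := perm (@dperm_inj t).

Lemma dpermP (t : tableau) k : initial (dperm t k) = t k.
Proof.
by rewrite permE /= (tnth_nth (t k)) /= nth_index ?mem_nodes.
Qed.

Definition residue (e : nat) (kappa : 'I_l -> 'Z_e) (x : node) : 'Z_e :=
  kappa (node_comp x) + 1 - (node_row x)%:R.

Definition initial_residues (e : nat) (kappa : 'I_l -> 'Z_e) :
  {ffun 'I_n -> 'Z_e} := [ffun k => residue kappa (initial k)].

End Tableaux.

(** [word_perm [:: r1; ...; rN]] is the function composite
    [s_r1 \o ... \o s_rN]: tableaux are acted upon on the right by [t \o w].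
    In the group ['S_n] this is the product in the reverse order. *)
Definition word_perm (n : nat) (w : seq 'I_n.-1) : 'S_n :=
  foldr (fun r v => (v * transp r)%g) 1%g w.

Lemma word_permE (n : nat) (r : 'I_n.-1) (w : seq 'I_n.-1) k :
  word_perm (r :: w) k = transp r (word_perm w k).
Proof. by rewrite /= permM. Qed.

Definition reduced_expression (n : nat) (w : 'S_n) (u : seq 'I_n.-1) : Prop :=
  word_perm u = w /\ forall v, word_perm v = w -> (size u <= size v)%N.

Definition charge (e l : nat) (khat : 'I_l -> int) (m : 'I_l) : 'Z_e :=
  (khat m)%:~R.

Record strongly_adjacency_free (e l n : nat) (khat : 'I_l -> int) : Prop := {
  saf_gap : forall i j : 'I_l, j = i.+1 :> nat -> n%:Z <= khat j - khat i;
  saf_adj : forall i j : 'I_l, i != j ->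
    let d := charge e khat i - charge e khat j in
    [/\ d != 0, d != 1 & d != -1];
  saf_ends : forall i j : 'I_l, i = 0%N :> nat -> j.+1 = l ->
    charge e khat i != charge e khat j + 2;
  saf_incr : forall i j : 'I_l, (i < j)%N ->
    (charge e khat i < charge e khat j)%N
}.

Section Spanning.
Variables (F : fieldType) (e l n : nat) (kappa : 'I_l -> 'Z_e).
Variable red : 'S_n -> seq 'I_n.-1.
Local Notation B := (blob F n kappa).

Definition psi_perm (w : 'S_n) : B := \prod_(r <- red w) blob_psi F kappa r.

Definition m_elt (lam : par1 l n) (s t : tableau lam) : B :=
  blob_star (psi_perm (dperm s)) * blob_idem F kappa (initial_residues lam kappa)
  * psi_perm (dperm t).

Definition C_set (x : B) : Prop :=
  exists (lam : par1 l n) (s t : tableau lam),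
    [/\ standard s, standard t & x = m_elt s t].

End Spanning.

Definition spans (F : fieldType) (V : lmodType F) (C : V -> Prop) : Prop :=
  forall x : V, exists2 s : seq (F * V),
    (forall p, p \in s -> C p.2) & x = \sum_(p <- s) p.1 *: p.2.

(* Main.v *)
Require Import Defs.
From mathcomp Require Import all_boot all_order all_fingroup all_algebra.
From mathcomp Require Import finmap monalg.
From mathcomp Require Import zify.

Set Implicit Arguments.
Unset Strict Implicit.
Unset Printing Implicit Defensive.

Import GRing.Theory.
Local Open Scope ring_scope.

(** A node in row [r] (counted from 0) of component [m] is encoded by the number
    [c = r * l + m].  The node order then is the reverse of the order of numbers,
    the tableau t^lambda lists the codes of lambda increasingly, and a one-column
    multipartition is a finite set of codes closed under [c |-> c - l]
    ([diagram]).  Diagrams are compared lexicographically as increasing lists;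
    smaller codes are [better].

    Let S be the span of the elements m_st and K the largest two-sided ideal
    contained in S ([core]).  Since 1 is the sum of the e(i), it is enough that K
    contains every e(i).  More generally, for every diagram b with at most n
    nodes, K contains e(i) as soon as the residue sequence i starts with the
    residues of b; the empty diagram gives all i.  The proof goes by induction
    on b, from better to worse diagrams and from longer to shorter ones
    ([idem_in_of_better]).

    If b has fewer than n nodes, let x be the residue that follows those of b in
    i, and pull the strand x to the left ([add_letter]).  Strong adjacency
    freeness says that the residues of the codes strictly between c and c + l
    are neither equal nor adjacent to those of c and c + l ([far_between]), so
    that the strand crosses them freely.  Either e(i) = 0, or x ends up as the
    residue of a new node, and a diagram that is better than b or extends b takes
    over, or x is stopped by a strand of residue x or x - 1, and then the
    nil-Hecke and braid relations factor e(i) through elements already known to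
    lie in K.
    The latter elements are found along the prefixes of b: dots on a prefix, and
    idempotents in which a node of b has its residue lowered by one
    ([prefixes_in]).

    If b has n nodes, write e for its idempotent.  The dots kill e modulo K.
    Hence, modulo K and shorter words in the psi_r, a product e psi_u depends only
    on the permutation of the reduced word u, by Matsumoto's theorem
    ([matsumoto], [short_braid]), and it is zero if u is not reduced
    ([short_nonreduced]).  It is also zero if the tableau of u is not standard:
    peeling off right descents that do not matter leaves a tableau that
    increases except for one descent, from the lower to the upper of two
    neighbouring nodes of a column ([short_inverted]), and its residue sequence
    gives an idempotent of K ([cell_single_descent]).  So e B is spanned modulo K
    by the e psi_d(t) with t standard ([cell_word]).  Applying the
    anti-involution on the left factor, B e B = (e B)^* (e B) is contained in
    S + K = S, that is, e lies in K ([full_in_core]). *)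

(** * Sorted lists *)

Lemma split_last_false (T : Type) (P : pred T) (s : seq T) :
  all P s \/ exists a x b, [/\ s = a ++ x :: b, ~~ P x & all P b].
Proof.
elim: s => [|x s [IH|[a [y [b [-> Py Pb]]]]]]; first by left.
  have [Px|nPx] := boolP (P x); first by left; rewrite /= Px.
  by right; exists [::], x, s.
by right; exists (x :: a), y, b.
Qed.

Lemma mem_split (T : eqType) (x : T) (s : seq T) :
  x \in s -> exists a b, s = a ++ x :: b.
Proof. by case/splitPr=> a b; exists a, b. Qed.

Lemma sorted_split d (s : seq nat) : sorted ltn s -> d \notin s ->
  s = [seq c <- s | (c < d)%N] ++ [seq c <- s | (d < c)%N].
Proof.
elim: s => // c s IH cs; rewrite inE negb_or => /andP[dc ds] /=.
have ss : sorted ltn s by apply: path_sorted cs.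
have /allP lt_s := order_path_min ltn_trans cs.
have [cd|dc'] := ltnP c d; first by rewrite ltnNge ltnW //= -IH.
have {}dc : (d < c)%N by rewrite ltn_neqAle dc.
have d_s x : x \in s -> (d < x)%N by move=> /lt_s /=; apply: ltn_trans.
rewrite dc (_ : [seq _ <- s | _] = [::]); last first.
  apply/eqP; rewrite -size_eq0 size_filter -leqn0 leqNgt -has_count.
  by apply/hasPn => x /d_s; rewrite -leqNgt => /ltnW.
by congr cons; apply/esym/all_filterP/allP.
Qed.

Lemma sorted_cons_cat (a b : seq nat) c : sorted ltn (a ++ c :: b) ->
  {in a, forall d, d < c}%N /\ {in b, forall d, c < d}%N.
Proof.
rewrite (sorted_pairwise ltn_trans) pairwise_cat pairwise_cons.
case/and3P=> /allrelP h _ /andP[/allP h' _].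
by split=> d ds; [apply: h; rewrite ?mem_head | apply: h'].
Qed.

Lemma enum_ord_pairwise n : pairwise (fun i j : 'I_n => i < j)%N (enum 'I_n).
Proof.
rewrite -(@pairwise_map _ _ val ltn) val_enum_ord -sorted_pairwise; last exact: ltn_trans.
exact: iota_ltn_sorted.
Qed.

(** * Straightening residue sequences *)

Section Straightening.

Variables (R : pzRingType) (l : nat) (kap : nat -> R).
Hypothesis l_gt1 : (1 < l)%N.
Let l_gt0 : (0 < l)%N := ltnW l_gt1.

(** The residues [x], [z] for which [psi_r ^ 2] acts as the identity on an
    idempotent with [x], [z] at the positions [r], [r + 1]. *)
Definition far (x z : R) : bool := [&& x != z, x != z + 1 & x != z - 1].

Lemma far_sym x z : far x z = far z x.
Proof.
rewrite /far (eq_sym z x) -(subr_eq z) (eq_sym (z - 1)) -(subr_eq z) opprK.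
by rewrite (eq_sym (z + 1)); congr andb; exact: andbC.
Qed.

(** Here [c %% l] is the component and [c %/ l] the row, counted from 0, of the
    node with code [c]. *)
Definition node_res (c : nat) : R := kap (c %% l) - (c %/ l)%:R.

Definition diagram (a : seq nat) : Prop :=
  sorted ltn a /\ forall c, c \in a -> (l <= c)%N -> (c - l)%N \in a.

(** Only a strict difference counts: an extension of a list is not better than
    the list.  This makes the relation stable when both lists are extended. *)
Definition better (b a : seq nat) : Prop :=
  exists p d c b' a', [/\ b = p ++ d :: b', a = p ++ c :: a' & (d < c)%N].

Hypothesis kap_far : forall i j, (i < l)%N -> (j < l)%N -> i != j -> far (kap i) (kap j).
Hypothesis kap_gap : forall i j, (i < j)%N -> (j < l)%N -> kap i != kap j + 1 + 1.

Lemma node_res_row c : (c < l)%N -> node_res c = kap c.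
Proof. by move=> cl; rewrite /node_res modn_small // divn_small // subr0. Qed.

Lemma node_resDl c : node_res (c + l) = node_res c - 1.
Proof. by rewrite /node_res modnDr divnDr // divnn l_gt0 natrD opprD addrA. Qed.

Lemma far_addr x z t : far (x + t) (z + t) = far x z.
Proof.
rewrite /far (inj_eq (addIr t)) addrAC (inj_eq (addIr t)).
by rewrite [z + t - 1]addrAC (inj_eq (addIr t)).
Qed.

Lemma far_gap i j : (i < j)%N -> (j < l)%N -> far (kap i) (kap j + 1).
Proof.
move=> ij jl.
have := kap_far (ltn_trans ij jl) jl; rewrite neq_ltn ij => /(_ isT) /and3P[h0 h1 _].
by rewrite /far h1 kap_gap // addrK h0.
Qed.

(** The geometric content of strong adjacency freeness: between two consecutive
    nodes of a column, in the order of codes, there is no strand that obstructs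
    the strand of either of them.  A code between [c] and [c + l] lies in the row
    of [c] in a later component, or in the next row in an earlier component;
    the residue differences that occur are excluded by [kap_far], except for the
    difference 2, excluded by [kap_gap]. *)
Lemma far_between c d : (c < d)%N -> (d < c + l)%N ->
  far (node_res d) (node_res c) && far (node_res d) (node_res c - 1).
Proof.
move=> cd dcl; rewrite -node_resDl.
have m_lt : (c %% l < l)%N by rewrite ltn_mod.
have m'_lt : (d %% l < l)%N by rewrite ltn_mod.
have [dq|dq] : (d %/ l = c %/ l \/ d %/ l = (c %/ l).+1)%N.
  have := divn_eq c l; have := divn_eq d l.
  move: (d %/ l)%N (c %/ l)%N (d %% l)%N (c %% l)%N m_lt m'_lt cd dcl.
  by move=> q q' m m' ? ? ? ? ? ?; nia.
- have mm : (c %% l < d %% l)%N.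
    by have := divn_eq c l; have := divn_eq d l; rewrite dq; lia.
  have fm : far (kap (c %% l)) (kap (d %% l)) by apply: kap_far => //; rewrite neq_ltn mm.
  rewrite node_resDl /node_res dq far_addr far_sym fm /=.
  rewrite addrAC far_addr far_sym -[far _ _](far_addr _ _ 1) subrK.
  exact: far_gap.
have mm : (d %% l < c %% l)%N.
  by have := divn_eq c l; have := divn_eq d l; rewrite dq mulSn; lia.
have fm : far (kap (d %% l)) (kap (c %% l)) by apply: kap_far => //; rewrite neq_ltn mm.
rewrite node_resDl /node_res dq -addn1 natrD opprD addrA.
rewrite [X in far _ X && _](_ : _ = (kap (c %% l) + 1 - (c %/ l)%:R) - 1); last first.
  by rewrite [_ + 1 - _]addrAC addrK.
by rewrite !far_addr fm far_gap.
Qed.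

Lemma resB1_neq (x : R) : x != x - 1.
Proof.
have /and3P[k01 _ _] := kap_far l_gt0 l_gt1 isT.
apply: contra k01 => /eqP h; rewrite -[kap 0]mul1r -[kap 1%N]mul1r.
by rewrite (_ : 1 = 0 :> R) ?mul0r //; apply: (addrI (x - 1)); rewrite subrK addr0.
Qed.

Lemma diagram_insert d (s : seq nat) : diagram s -> d \notin s ->
  ((l <= d)%N -> (d - l)%N \in s) ->
  diagram ([seq c <- s | (c < d)%N] ++ d :: [seq c <- s | (d < c)%N]).
Proof.
move=> [ss cl] ds dl; split; last first.
  move=> c; rewrite mem_cat inE orbCA -mem_cat -sorted_split //.
  case/orP => [/eqP-> /dl|cs /(cl _ cs)] h;
    by rewrite mem_cat inE orbCA -mem_cat -sorted_split // h orbT.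
have st : sorted ltn [seq c <- s | (c < d)%N] by apply: sorted_filter ss; apply: ltn_trans.
have st' : sorted ltn [seq c <- s | (d < c)%N] by apply: sorted_filter ss; apply: ltn_trans.
rewrite sorted_pairwise; last exact: ltn_trans.
rewrite pairwise_cat /= -!(sorted_pairwise ltn_trans) st st' filter_all !andbT /=.
apply/allrelP => x y; rewrite mem_filter inE mem_filter => /andP[xd _] /orP[/eqP->//|/andP[dy _]].
exact: ltn_trans dy.
Qed.

(** A node inserted in the middle makes a diagram strictly better, whatever is
    appended to the diagram later. *)
Lemma better_or_extend d (s : seq nat) : sorted ltn s -> d \notin s ->
  let s' := [seq c <- s | (c < d)%N] ++ d :: [seq c <- s | (d < c)%N] in
  s' = rcons s d \/ forall r, better s' (s ++ r).
Proof.
move=> ss ds /=; have := sorted_split ss ds.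
case gt_d: [seq c <- s | (d < c)%N] => [|c s'] sE.
  by left; rewrite cats1 [in RHS]sE cats0.
right=> r; rewrite [X in X ++ r]sE; exists [seq c <- s | (c < d)%N], d, c, (c :: s'), (s' ++ r).
rewrite -catA; split=> //.
by have := mem_head c s'; rewrite -gt_d mem_filter => /andP[].
Qed.

Lemma diagram_prefix a b : diagram (a ++ b) -> diagram a.
Proof.
move=> [ss cl]; split; first by case/cat_sorted2: (ss).
move=> c ca lc; have := cl c; rewrite !mem_cat ca => /(_ isT lc) /orP[//|cb].
move: ss; rewrite (sorted_pairwise ltn_trans) pairwise_cat => /and3P[/allrelP h _ _].
by have := h _ _ ca cb; rewrite /= => ?; lia.
Qed.

Variables (idem_in : seq R -> Prop) (dot_in : nat -> seq R -> Prop).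

(** What is used of the algebra in the straightening argument, where
    [idem_in t] stands for the membership in an ideal of the idempotent of the
    residue sequence [t], and [dot_in p t] for that of its product with the dot at
    the position [p], counted from 0. *)
Record straightening_rules : Prop := {
  rule_far : forall a x z b, far x z ->
    idem_in (a ++ z :: x :: b) -> idem_in (a ++ x :: z :: b);
  rule_far_dot : forall a x z b, far x z ->
    dot_in (size a) (a ++ z :: x :: b) -> dot_in (size a).+1 (a ++ x :: z :: b);
  rule_eq : forall a x b,
    dot_in (size a) (a ++ x :: x :: b) -> idem_in (a ++ x :: x :: b);
  rule_down_dot : forall a x b, dot_in (size a) (a ++ x :: x - 1 :: b) ->
    idem_in (a ++ x - 1 :: x :: b) -> dot_in (size a).+1 (a ++ x :: x - 1 :: b);
  rule_braid : forall a x b, idem_in (a ++ x :: x :: x - 1 :: b) ->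
    idem_in (a ++ x - 1 :: x :: x :: b) -> idem_in (a ++ x :: x - 1 :: x :: b);
  rule_first : forall x b, (forall i, (i < l)%N -> x != kap i) -> idem_in (x :: b);
  rule_second : forall i b, (i < l)%N -> idem_in (kap i :: kap i + 1 :: b);
  rule_first_dot : forall i b, (i < l)%N -> dot_in 0 (kap i :: b)
}.

Hypothesis rules : straightening_rules.

(** The strand [x] is pulled to the left across [b]. *)
Lemma idem_in_pull a b x c : all (far x) b -> idem_in (a ++ x :: b ++ c) -> idem_in (a ++ b ++ x :: c).
Proof.
elim: b a => //= z b IH a /andP[xz xb] h; rewrite -cat_rcons; apply: IH => //.
by rewrite cat_rcons; apply: (rule_far rules); rewrite // far_sym.
Qed.

Lemma dot_in_pull a b x c : all (far x) b -> dot_in (size a) (a ++ x :: b ++ c) ->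
  dot_in (size a + size b) (a ++ b ++ x :: c).
Proof.
elim: b a => [|z b IH] a /=; first by rewrite addn0.
move=> /andP[xz xb] h; rewrite -cat_rcons addnS -addSn -(size_rcons a z).
by apply: IH => //; rewrite cat_rcons size_rcons; apply: (rule_far_dot rules); rewrite // far_sym.
Qed.

Local Notation rs := (map node_res).

Lemma all_far_between x (s : seq nat) c : (x = node_res c \/ x = node_res c - 1) ->
  {in s, forall d, c < d < c + l}%N -> all (far x) (rs s).
Proof.
move=> hx hs; rewrite all_map; apply/allP => d /hs /andP[cd dc] /=.
by have /andP[f1 f2] := far_between cd dc; case: hx => ->; rewrite far_sym.
Qed.

Section Prefixes.

Variable lam : seq nat.
Hypothesis lam_diagram : diagram lam.
Hypothesis idem_in_better : forall b t, diagram b -> better b lam -> idem_in (rs b ++ t).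

(** Two facts on the prefixes of length at most [k] of [lam], proved together:
    the idempotents where the last node has its residue lowered by one lie in
    the ideal, and so do the dots. *)
Definition misplaced_in k := forall b c r t, lam = b ++ c :: r -> (size b < k)%N ->
  idem_in (rs b ++ node_res c - 1 :: t).
Definition dots_in k := forall b r p t, lam = b ++ r -> (size b <= k)%N ->
  (p < size b)%N -> dot_in p (rs b ++ t).

(** The strand [x] is pulled to the left across the strands of the diagram [b].
    It either leads to the ideal or finds its place as a new node [d] of
    residue [x].  The last strand that it cannot cross decides: residue [x + 1]
    at a node [c] means that [c + l] is addable; residue [x] is treated by the
    nil-Hecke rule and the dots on a prefix of [b]; residue [x - 1] at a node
    below the first row is treated by the braid rule together with the node
    above it, which has residue [x]; residue [x - 1] in the first row leads to a
    sequence that starts with [kap c; kap c + 1].  If no strand stops [x], it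
    becomes the first letter, and it is either a first-row node or killed. *)
Lemma add_letter b r x t : lam = b ++ r -> misplaced_in (size b) -> dots_in (size b) ->
  idem_in (rs b ++ x :: t) \/
  exists d, [/\ d \notin b, (l <= d)%N -> (d - l)%N \in b, node_res d = x &
    idem_in (rs ([seq c <- b | (c < d)%N] ++ d :: [seq c <- b | (d < c)%N]) ++ t) ->
    idem_in (rs b ++ x :: t)].
Proof.
move=> lamE dropK dotsK.
have [bs bcl] : diagram b by move: lam_diagram; rewrite lamE; apply: diagram_prefix.
have insert d : d \notin b -> node_res d = x ->
    {in b, forall c, d < c -> far x (node_res c)}%N ->
    idem_in (rs ([seq c <- b | (c < d)%N] ++ d :: [seq c <- b | (d < c)%N]) ++ t) ->
    idem_in (rs b ++ x :: t).
  move=> db dx bx; rewrite {3}(sorted_split bs db) !map_cat /= -!catA /= dx.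
  apply: idem_in_pull; rewrite all_map; apply/allP => c /=.
  by rewrite mem_filter => /andP[dc cb]; apply: bx.
(* [c] is the last code of [b] whose strand stops [x]. *)
have [farb|[b1 [c [b2 [bE ncx far2]]]]] := split_last_false (preim node_res (far x)) b.
  have [/'exists_eqP [i xi]|nx] := boolP [exists i : 'I_l, x == kap i].
    have d_i : node_res i = x by rewrite node_res_row.
    have ib : (i : nat) \notin b.
      by apply/negP => /(allP farb) /=; rewrite d_i /far eqxx.
    right; exists (i : nat); split => //; first by rewrite leqNgt ltn_ord.
    by apply: insert => // c /(allP farb).
  left; refine (@idem_in_pull [::] (rs b) x t _ _); first by rewrite all_map.
  apply: (rule_first rules) => i il; apply: contra nx => xi.
  by apply/existsP; exists (Ordinal il).
have [b1c b2c] : {in b1, forall d, d < c}%N /\ {in b2, forall d, c < d}%N.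
  by apply: sorted_cons_cat; rewrite -bE.
have lamE1 : lam = b1 ++ c :: (b2 ++ r) by rewrite lamE bE -catA.
have lamE1' : lam = rcons b1 c ++ (b2 ++ r) by rewrite cat_rcons.
have pull2 : idem_in (rs b1 ++ node_res c :: x :: rs b2 ++ t) -> idem_in (rs b ++ x :: t).
  rewrite bE map_cat /= -!catA /= -![rs b1 ++ node_res c :: _]cat_rcons; apply: idem_in_pull.
  by rewrite all_map.
have [xc|xc] := eqVneq x (node_res c).
  left; apply: pull2; rewrite -xc; apply: (rule_eq rules); rewrite size_map xc.
  have := dotsK (rcons b1 c) _ (size b1) (node_res c :: rs b2 ++ t) lamE1'.
  by rewrite size_rcons map_rcons cat_rcons; apply=> //; rewrite bE size_cat /=; lia.
have [cx|cx] := eqVneq x (node_res c - 1).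
  have d_x : node_res (c + l) = x by rewrite node_resDl.
  have farb2 e : e \in b -> (c < e)%N -> far x (node_res e).
    rewrite bE mem_cat inE => /or3P[/b1c|/eqP->|/(allP far2)//]; last by rewrite ltnn.
    by move=> h h'; lia.
  have db : (c + l)%N \notin b.
    apply/negP => /farb2; rewrite d_x /far eqxx.
    by rewrite -[X in (X < _)%N]addn0 ltn_add2l => /(_ l_gt0).
  right; exists (c + l)%N; split=> //.
    by rewrite addnK bE mem_cat inE eqxx orbT.
  by apply: insert => // e eb ce; apply: farb2 => //; lia.
have {}ncx : x = node_res c + 1.
  by move: ncx; rewrite /= /far xc cx andbT /= negbK => /eqP.
have cx1 : node_res c = x - 1 by rewrite ncx addrK.
left; apply: pull2; rewrite cx1.
have [cl|lc] := ltnP c l.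
  have fk : {in b1, forall d, far (kap c) (kap d) && far (kap c + 1) (kap d)}.
    move=> d /b1c dc; have dl := ltn_trans dc cl.
    by rewrite kap_far ?neq_ltn ?dc ?orbT //= far_sym far_gap.
  have kc : x - 1 = kap c by rewrite -cx1 node_res_row.
  have kc' : x = kap c + 1 by rewrite ncx node_res_row.
  have farb1 d : d \in b1 -> node_res d = kap d.
    by move=> /b1c dc; rewrite node_res_row // (ltn_trans dc).
  refine (@idem_in_pull [::] (rs b1) _ _ _ _).
    by rewrite all_map; apply/allP => d db1 /=; rewrite farb1 // kc; case/andP: (fk d db1).
  refine (@idem_in_pull [:: x - 1] (rs b1) _ _ _ _).
    by rewrite all_map; apply/allP => d db1 /=; rewrite farb1 // kc'; case/andP: (fk d db1).
  by rewrite kc kc'; apply: (rule_second rules).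
(* The node [c0] above [c] has residue [x]; the strands of [c] and of [x] are
   pulled next to it to form the pattern [x; x - 1; x]. *)
have : (c - l)%N \in b by apply: bcl => //; rewrite bE mem_cat inE eqxx orbT.
rewrite bE mem_cat inE => /or3P[cb1|/eqP h|/b2c h]; [|by exfalso; lia|by exfalso; lia].
have [c0 cE] : exists c0, c = (c0 + l)%N by exists (c - l)%N; rewrite subnK.
rewrite cE addnK in cb1.
have c0x : node_res c0 = x by apply: (addIr (-1)); rewrite -node_resDl -cE.
have [b3 [b4 b1E]] := mem_split cb1.
have b4c : {in b4, forall d, c0 < d < c0 + l}%N.
  move=> d db4; rewrite -cE b1c ?b1E ?mem_cat ?inE ?db4 ?orbT // andbT.
  have [_ ->//] : {in b3, forall d, d < c0}%N /\ {in b4, forall d, c0 < d}%N.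
  by apply: sorted_cons_cat; move: bs; rewrite bE b1E => /cat_sorted2[].
have pull4 z y t' : (z = x \/ z = x - 1) ->
    idem_in (y ++ z :: rs b4 ++ t') -> idem_in (y ++ rs b4 ++ z :: t').
  by move=> hz; apply: idem_in_pull; apply: (all_far_between (c := c0)); rewrite ?c0x.
have lamE3 : lam = b3 ++ c0 :: (b4 ++ c :: b2 ++ r) by rewrite lamE1 b1E -catA.
rewrite b1E map_cat /= -!catA /= c0x -[rs b3 ++ _]cat_rcons; apply: (pull4); first by right.
rewrite -cat_rcons; apply: pull4; first by left.
rewrite !cat_rcons; apply: (rule_braid rules).
  apply: (rule_eq rules); rewrite size_map -c0x -cat_rcons -map_rcons.
  apply: (dotsK _ (b4 ++ c :: b2 ++ r)); rewrite ?cat_rcons ?size_rcons //.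
  by rewrite bE b1E !size_cat /=; lia.
rewrite -c0x; apply: dropK lamE3 _.
by rewrite bE b1E !size_cat /=; lia.
Qed.

(** By induction on [k].  In the first case, [add_letter] applied to the prefix
    [b] and to the lowered residue of the next node [c] can only add a node
    before [c], by [far_between], and this makes the diagram better.  In the
    second case, the dot on the last strand is pulled with its strand to the
    beginning, where it vanishes, or next to the strand of the node above, where
    the quadratic relation moves it to that strand at the cost of a sequence of
    the first kind. *)
Lemma prefixes_in k : (k <= size lam)%N -> misplaced_in k /\ dots_in k.
Proof.
elim: k => [|k IH] klam; first by split=> [b c r t _ //|[|//] r p t].
have [dropK dotsK] := IH (ltnW klam).
have dropS : misplaced_in k.+1.
  move=> b c r t lamE; rewrite ltnS leq_eqVlt => /orP[/eqP bk|]; last exact: (dropK _ _ _ _ lamE).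
  have := @add_letter b (c :: r) (node_res c - 1) t lamE.
  rewrite bk => /(_ dropK dotsK) [//|[d [db dl dc]]]; apply.
  have bsh : diagram b by move: lam_diagram; rewrite lamE; apply: diagram_prefix.
  apply: idem_in_better; first exact: diagram_insert.
  have bc : {in b, forall d, d < c}%N.
    by have [ss _] := lam_diagram; move: ss; rewrite lamE => /sorted_cons_cat[].
  have cb : c \notin b by apply/negP => /bc; rewrite ltnn.
  have d_lt_c : (d < c)%N.
    rewrite ltnNge leq_eqVlt; apply/negP => /orP[/eqP cd|cd].
      by move: dc; rewrite -cd => /eqP; rewrite (negPf (resB1_neq _)).
    have [dcl|] := ltnP d (c + l).
      by have /andP[_] := far_between cd dcl; rewrite dc /far eqxx.
    rewrite leq_eqVlt => /orP[/eqP dE|cld].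
      by move: dl; rewrite -dE addnK leq_addl (negPf cb) => /(_ isT).
    by have := bc (d - l)%N; rewrite dl; lia.
  have [bs _] := bsh; rewrite lamE.
  have [->|//] := better_or_extend bs db.
  by exists b, d, c, [::], r; rewrite cats1.
split=> // b r p t lamE; rewrite leq_eqVlt => /orP[/eqP bk|]; last exact: (dotsK _ _ _ _ lamE).
case/lastP: b lamE bk => // b c lamE; rewrite size_rcons => -[bk].
rewrite ltnS leq_eqVlt => /orP[/eqP->|pb]; last first.
  rewrite map_rcons cat_rcons; apply: (dotsK b (c :: r)); rewrite ?bk // -?cat_rcons //.
  by rewrite -bk.
have lamE' : lam = b ++ c :: r by rewrite -cat_rcons.
rewrite map_rcons cat_rcons.
have [bs bcl] : diagram (rcons b c) by move: lam_diagram; rewrite lamE; apply: diagram_prefix.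
have bc : {in b, forall d, d < c}%N.
  by have [ss _] := lam_diagram; move: ss; rewrite lamE' => /sorted_cons_cat[].
have [cl|lc] := ltnP c l.
  rewrite -[X in dot_in X _]add0n -(size_map node_res b).
  apply: (dot_in_pull (a := [::])); last by rewrite /= node_res_row //; apply: (rule_first_dot rules).
  rewrite all_map; apply/allP => d /bc dc /=; have dl := ltn_trans dc cl.
  by rewrite !node_res_row // kap_far // neq_ltn dc orbT.
have := bcl c; rewrite !mem_rcons mem_head inE => /(_ isT lc) /orP[/eqP h|]; first by exfalso; lia.
have [c0 cE] : exists c0, c = (c0 + l)%N by exists (c - l)%N; rewrite subnK.
rewrite cE addnK node_resDl => /mem_split[b3 [b4 bE]].
have lamE3 : lam = rcons b3 c0 ++ (b4 ++ c :: r) by rewrite lamE' bE cat_rcons -catA.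
rewrite bE size_cat map_cat /= addnS -addSn -catA /= -cat_rcons.
rewrite -(size_map node_res b4) -(size_map node_res b3).
rewrite -(size_rcons (rs b3) (node_res c0)).
apply: dot_in_pull.
  apply: (all_far_between (c := c0)); first by right.
  move=> d db4; rewrite -cE bc ?bE ?mem_cat ?inE ?db4 ?orbT // andbT.
  have [_ ->//] : {in b3, forall d, d < c0}%N /\ {in b4, forall d, c0 < d}%N.
  by apply: sorted_cons_cat; rewrite -bE; move: bs; rewrite -cats1 => /cat_sorted2[].
rewrite size_rcons cat_rcons; apply: (rule_down_dot rules).
  rewrite -cat_rcons -map_rcons; apply: (dotsK _ _ _ _ lamE3).
    by rewrite -bk bE size_rcons size_cat /=; lia.
  by rewrite size_map size_rcons.
apply: dropK; first by rewrite lamE3 cat_rcons.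
by rewrite -bk bE size_cat /=; lia.
Qed.

(** The form needed for tableaux that are not standard: the node below [c] comes
    before [c], separated from the nodes before [c] by harmless strands only. *)
Lemma idem_in_misplaced b c r (m : seq nat) t : lam = b ++ c :: r ->
  {in m, forall d, c < d < c + l}%N -> idem_in (rs (b ++ m) ++ node_res c - 1 :: t).
Proof.
move=> lamE mc; rewrite map_cat -catA; apply: idem_in_pull.
  by apply: all_far_between mc; right.
have [dropK _] := prefixes_in (leqnn _); apply: (dropK _ _ _ _ lamE).
by rewrite lamE size_cat /=; lia.
Qed.

Lemma dot_in_full p t : (p < size lam)%N -> dot_in p (rs lam ++ t).
Proof.
by have [_ dotsK] := prefixes_in (leqnn _); apply: (dotsK lam [::]); rewrite ?cats0.
Qed.

End Prefixes.

Variable n : nat.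
Hypothesis idem_in_size : forall s, size s != n -> idem_in s.
Hypothesis idem_in_full : forall lam t, diagram lam -> size lam = n ->
  (forall b t', diagram b -> better b lam -> idem_in (rs b ++ t')) -> idem_in (rs lam ++ t).

(** Induction on the number [k] of missing nodes.  A new node that is not the last
    one makes the diagram better; for a new last node [d] one uses the
    inductive hypothesis, whose own hypothesis on better diagrams follows by a
    second induction on [d]. *)
Lemma idem_in_of_better k lam t : diagram lam -> (size lam + k)%N = n ->
  (forall b t', diagram b -> better b lam -> idem_in (rs b ++ t')) -> idem_in (rs lam ++ t).
Proof.
elim: k lam t => [|k IH] lam t lam_sh lamn betterK.
  by apply: idem_in_full; rewrite // -lamn addn0.
case: t => [|x t]; first by apply: idem_in_size; rewrite cats0 size_map -lamn; lia.
have extK d : forall t', diagram (rcons lam d) -> idem_in (rs (rcons lam d) ++ t').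
  elim/ltn_ind: d => d IHd t' sh; apply: IH; rewrite ?size_rcons // ?addSnnS //.
  move=> b t1 bsh [p [d' [c [b' [a' [bE lamE d'c]]]]]].
  case/lastP: a' lamE => [|a' e].
    rewrite cats1 => /rcons_inj[pE cE]; rewrite -{}pE -cat_rcons in bE.
    rewrite bE map_cat -catA; apply: IHd; first by rewrite cE.
    by move: bsh; rewrite bE; apply: diagram_prefix.
  rewrite -rcons_cons -rcons_cat => /rcons_inj[lamE _].
  by apply: betterK => //; exists p, d', c, b', a'.
have [dropK dotsK] := prefixes_in lam_sh betterK (leqnn _).
have [//|[d [dlam dl dx]]] := add_letter lam_sh x t (esym (cats0 lam)) dropK dotsK.
apply; have [lam_s _] := lam_sh; have sh := diagram_insert lam_sh dlam dl.
have [E|/(_ [::])] := better_or_extend lam_s dlam; last by rewrite cats0; apply: betterK.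
by rewrite E; apply: extK; rewrite -E.
Qed.

Lemma idem_in_all t : idem_in t.
Proof.
apply: (@idem_in_of_better n [::]) => // b t' _ [p [d [c [b' [a' [_ h _]]]]]].
by case: p h.
Qed.

End Straightening.

(** * Reduced words in the symmetric group *)

Section Matsumoto.
Variable n : nat.
Implicit Types (w : 'S_n) (r s : 'I_n.-1) (u v z : seq 'I_n.-1).

Lemma transp_fst r : transp r (fst_pos r) = snd_pos r.
Proof. exact: tpermL. Qed.

Lemma transp_snd r : transp r (snd_pos r) = fst_pos r.
Proof. exact: tpermR. Qed.

Lemma transp_id r (k : 'I_n) : k != r :> nat -> k != r.+1 :> nat -> transp r k = k.
Proof. by move=> kr kr1; rewrite /transp tpermD // -val_eqE eq_sym. Qed.

Lemma transpK r : (transp r * transp r = 1)%g.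
Proof. exact: tperm2. Qed.

Lemma mul_transpK r w : (transp r * (transp r * w) = w)%g.
Proof. by rewrite mulgA transpK mul1g. Qed.

Lemma transp_comm r s : (r.+1 < s)%N || (s.+1 < r)%N ->
  (transp r * transp s = transp s * transp r)%g.
Proof.
by move=> rs; rewrite conjgC tpermJ !transp_id //=; lia.
Qed.

Lemma transp_braid r s : s = r.+1 :> nat ->
  (transp r * transp s * transp r = transp s * transp r * transp s)%g.
Proof.
move=> /pos_braid[fs ab ac bc]; apply/permP => k; rewrite !permM /transp fs.
by have [-> ->] := tperm_braid k ab ac bc.
Qed.

Lemma word_perm_rcons u r : word_perm (rcons u r) = (transp r * word_perm u)%g.
Proof. by elim: u => [|s u IH] /=; rewrite ?mul1g ?mulg1 // IH mulgA. Qed.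

Definition descent w r := (w (snd_pos r) < w (fst_pos r))%N.

Definition inversions w := [set p : 'I_n * 'I_n | (p.1 < p.2)%N && (w p.2 < w p.1)%N].

(** An adjacent transposition preserves the order of every other pair, so that
    it creates or removes exactly one inversion of a permutation. *)
Lemma transp_lt r (a b : 'I_n) : (a, b) != (fst_pos r, snd_pos r) ->
  (a < b)%N -> (transp r a < transp r b)%N.
Proof.
rewrite /transp xpair_eqE => ne ab; move: ne ab.
have neq x x' : x <> x' :> 'I_n -> x <> x' :> nat by move=> h /val_inj.
case: tpermP => [->|->|/neq + /neq]; case: tpermP => [->|->|/neq + /neq];
  by rewrite /= ?eqxx //; lia.
Qed.

Lemma inversions_transp w r : ~~ descent w r ->
  #|inversions (transp r * w)| = #|inversions w|.+1.
Proof.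
move=> asc; set p0 := (fst_pos r, snd_pos r).
have lt_w : (w (fst_pos r) < w (snd_pos r))%N.
  rewrite ltn_neqAle leqNgt asc andbT; apply/negP => /eqP /val_inj /perm_inj /(congr1 val) /=.
  by lia.
pose f (p : 'I_n * 'I_n) := (transp r p.1, transp r p.2).
have fK : involutive f by case=> a b; rewrite /f /= -!permM transpK !perm1.
have p0_inv : p0 \in inversions (transp r * w).
  by rewrite inE /= ltnSn !permM transp_fst transp_snd.
have ltf p : p != p0 -> (p.1 < p.2)%N -> ((f p).1 < (f p).2)%N.
  by case: p => a b ne; apply: transp_lt.
rewrite (cardsD1 p0) p0_inv add1n; congr _.+1.
rewrite -(card_preimset _ (inv_inj fK)); apply: eq_card => p; rewrite !inE !permM.
have -> : transp r (f p).1 = p.1 by rewrite -[in RHS](fK p).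
have -> : transp r (f p).2 = p.2 by rewrite -[in RHS](fK p).
have [inv_p|] := ltnP (w p.2) (w p.1); last by rewrite !andbF.
rewrite !andbT; apply/andP/idP => [[ne lt_fp]|lt_p].
  by have := ltf _ ne lt_fp; rewrite fK.
split; last by apply: ltf lt_p; apply: contraTneq inv_p => ->; rewrite -leqNgt ltnW.
apply: contraTneq lt_p => /(congr1 f); rewrite fK => ->.
by rewrite /f /= transp_fst transp_snd /= -leqNgt leqnSn.
Qed.

Lemma inversions_descent w r : descent w r ->
  #|inversions w| = #|inversions (transp r * w)|.+1.
Proof.
move=> d; rewrite -{1}(mul_transpK r w) inversions_transp //.
by rewrite /descent !permM transp_fst transp_snd -leqNgt ltnW.
Qed.

Lemma incr_of_no_descent w (i j : 'I_n) : (i < j)%N ->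
  (forall r, (i <= r < j)%N -> ~~ descent w r) -> (w i < w j)%N.
Proof.
case: j => j; elim: j => // j IH jn /= ij asc.
have r_lt : (j < n.-1)%N by lia.
have := asc (Ordinal r_lt); rewrite /= ltnSn andbT -ltnS => /(_ ij).
rewrite /descent -leqNgt leq_eqVlt => /orP[/eqP|].
  by move/val_inj/perm_inj/(congr1 val) => /=; lia.
have -> : snd_pos (Ordinal r_lt) = Ordinal jn by apply: val_inj.
move: ij; rewrite ltnS leq_eqVlt => /orP[/eqP ij|ij].
  by have -> : fst_pos (Ordinal r_lt) = i by apply: val_inj.
apply: ltn_trans; have -> : fst_pos (Ordinal r_lt) = Ordinal (ltnW jn) by apply: val_inj.
by apply: IH => // r /andP[ir rj]; apply: asc; rewrite ir /= ltnS ltnW.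
Qed.

Lemma no_descent_id w : (forall r, ~~ descent w r) -> w = 1%g.
Proof.
move=> asc; have srt : sorted ltn [seq val (w i) | i <- enum 'I_n].
  rewrite (sorted_pairwise ltn_trans) pairwise_map.
  by apply: sub_pairwise (enum_ord_pairwise n) => i j ij; apply: incr_of_no_descent.
have E : [seq val (w i) | i <- enum 'I_n] = map val (enum 'I_n).
  apply: (irr_sorted_eq ltn_trans ltnn srt).
    by rewrite val_enum_ord iota_ltn_sorted.
  move=> k; apply/mapP/mapP => -[i _ ->]; first by exists (w i); rewrite ?mem_enum.
  by exists (w^-1 i)%g; rewrite ?mem_enum ?permKV.
apply/permP => i; rewrite perm1; apply: val_inj.
have /eq_in_map/(_ i) : [seq val (w i) | i <- enum 'I_n] = [seq val i | i <- enum 'I_n] by exact: E.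
by apply; rewrite mem_enum.
Qed.

Lemma exists_word w : exists2 u, word_perm u = w & size u = #|inversions w|.
Proof.
move: {2}#|_| (erefl #|inversions w|) => k; elim: k w => [|k IH] w wk.
  exists [::] => //; apply/esym/no_descent_id => r.
  by apply/negP => /inversions_descent; rewrite wk.
have [/existsP[r d]|/existsPn/no_descent_id w1] := boolP [exists r, descent w r].
  have inv_w := inversions_descent d; have := inv_w; rewrite wk => -[/esym/IH[u uE us]].
  exists (rcons u r); first by rewrite word_perm_rcons uE mul_transpK.
  by rewrite size_rcons us -inv_w -wk.
suff : #|inversions w| = 0 by rewrite wk.
apply: eq_card0 => p; rewrite inE w1 !perm1; apply/negbTE/negP => /andP[? ?]; lia.
Qed.

Lemma inversions_word u : (#|inversions (word_perm u)| <= size u)%N.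
Proof.
elim/last_ind: u => [|u r IH].
  by rewrite leqn0; apply/eqP/eq_card0 => p; rewrite inE /= !perm1; apply/negbTE/negP; lia.
rewrite word_perm_rcons size_rcons; have [d|d] := boolP (descent (word_perm u) r).
  by have := inversions_descent d; lia.
by rewrite inversions_transp.
Qed.

(** Minimality of the length in terms of inversions, see [inversions_word] and
    [exists_word]. *)
Definition reduced u := size u == #|inversions (word_perm u)|.

Lemma reduced_expressionP w u : reduced_expression w u -> word_perm u = w /\ reduced u.
Proof.
move=> [uE min]; split=> //; have [v vE vs] := exists_word w.
by rewrite /reduced eqn_leq inversions_word uE -vs min.
Qed.

Lemma reduced_rcons u r : reduced (rcons u r) ->
  reduced u /\ descent (word_perm (rcons u r)) r.
Proof.
rewrite /reduced word_perm_rcons size_rcons => /eqP E; have := inversions_word u.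
have [d|d] := boolP (descent (word_perm u) r).
  by have := inversions_descent d; lia.
move: E; rewrite inversions_transp // => -[->] _; rewrite eqxx; split=> //.
rewrite /descent !permM transp_fst transp_snd ltn_neqAle leqNgt d andbT.
by apply/negP => /eqP /val_inj /perm_inj /(congr1 val) /=; lia.
Qed.

Inductive braid_eq : seq 'I_n.-1 -> seq 'I_n.-1 -> Prop :=
| braid_refl u : braid_eq u u
| braid_sym u v of braid_eq u v : braid_eq v u
| braid_trans u v z of braid_eq u v & braid_eq v z : braid_eq u z
| braid_comm a r s b of (r.+1 < s)%N || (s.+1 < r)%N :
    braid_eq (a ++ r :: s :: b) (a ++ s :: r :: b)
| braid_move a r s b of s = r.+1 :> nat :
    braid_eq (a ++ r :: s :: r :: b) (a ++ s :: r :: s :: b).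

Lemma braid_cat u v b : braid_eq u v -> braid_eq (u ++ b) (v ++ b).
Proof.
elim=> [u1|u1 u2 _|u1 u2 u3 _ IH1 _ IH2|a r s c rs|a r s c rs].
- exact: braid_refl.
- exact: braid_sym.
- exact: braid_trans IH2.
- by rewrite -!catA; apply: braid_comm.
by rewrite -!catA; apply: braid_move.
Qed.

Lemma braid_rcons u v r : braid_eq u v -> braid_eq (rcons u r) (rcons v r).
Proof. by rewrite -!cats1; apply: braid_cat. Qed.

Lemma braid_size u v : braid_eq u v -> size u = size v.
Proof.
by elim=> // [u1 u2 u3 _ -> _ ->//|a r s c rs|a r s c rs]; rewrite !size_cat.
Qed.

(** The inductive step of Matsumoto's theorem when the last letters [r], [s] are
    neighbours: [w] has descents at [r] and [s], hence a reduced word ending with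
    [r; s; r], and another one ending with [s; r; s]. *)
Lemma matsumoto_adjacent k u v r s :
  (forall u v, size u = k -> reduced u -> reduced v -> word_perm u = word_perm v -> braid_eq u v) ->
  s = r.+1 :> nat -> size u = k -> size v = k -> reduced u -> reduced v ->
  descent (word_perm (rcons u r)) r -> descent (word_perm (rcons v s)) s ->
  word_perm (rcons u r) = word_perm (rcons v s) -> braid_eq (rcons u r) (rcons v s).
Proof.
move=> IH sr us vs ru rv dr ds E.
move: ds; rewrite -E; set w := word_perm (rcons u r) in E dr * => ds.
have uE : word_perm u = (transp r * w)%g by rewrite /w word_perm_rcons mul_transpK.
have vE : word_perm v = (transp s * w)%g by rewrite E word_perm_rcons mul_transpK.
have [fs _ _ _] := pos_braid sr.
have t_sr : transp r (snd_pos s) = snd_pos s by apply: transp_id => /=; lia.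
have t_rs : transp s (fst_pos r) = fst_pos r by apply: transp_id => /=; lia.
rewrite /descent fs in ds; rewrite /descent in dr.
have d1 : descent (transp r * w)%g s.
  by rewrite /descent !permM fs t_sr transp_snd (ltn_trans ds).
have d2 : descent (transp s * (transp r * w))%g r.
  by rewrite /descent !permM t_rs transp_fst -{1}fs transp_fst t_sr.
have [z zE zs] := exists_word (transp r * (transp s * (transp r * w))).
have inv_z : (#|inversions w| = (size z).+3)%N.
  by rewrite (inversions_descent dr) (inversions_descent d1) (inversions_descent d2) zs.
have inv_w : #|inversions w| = k.+1.
  rewrite (inversions_descent dr) -uE; congr _.+1; rewrite -us; exact/esym/eqP.
have zk : (size z).+2 = k by move: inv_z; rewrite inv_w => -[].
have zrsE : word_perm (rcons (rcons z r) s) = word_perm u.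
  by rewrite !word_perm_rcons zE !mul_transpK uE.
have zsrE : word_perm (rcons (rcons z s) r) = word_perm v.
  rewrite !word_perm_rcons zE vE !mulgA (transp_braid sr).
  by rewrite -(mulgA (transp s * transp r)%g) transpK mulg1 -(mulgA (transp s)) transpK mulg1.
have uz : braid_eq u (rcons (rcons z r) s).
  by apply: IH; rewrite ?zrsE // /reduced zrsE !size_rcons zk -us.
have vz : braid_eq v (rcons (rcons z s) r).
  by apply: IH; rewrite ?zsrE // /reduced zsrE !size_rcons zk -vs.
apply: braid_trans (braid_rcons r uz) _.
apply: braid_trans (braid_sym (braid_rcons s vz)).
by rewrite -!cats1 -!catA; apply: braid_move.
Qed.

(** By induction on the length.  If the last letters [r], [s] differ, both are
    right descents of the permutation, which therefore has reduced words ending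
    with [r] and [s] that are related by one braid move; the inductive
    hypothesis links these words to [u] and [v]. *)
Lemma matsumoto u v : reduced u -> reduced v -> word_perm u = word_perm v -> braid_eq u v.
Proof.
move: {2}(size u) (erefl (size u)) => k; elim: k u v => [|k IH] u v us ru rv uv.
  move: rv; rewrite /reduced -uv -(eqP ru) us => /eqP vs.
  by rewrite (size0nil us) (size0nil vs); apply: braid_refl.
have vs : size v = k.+1 by rewrite (eqP rv) -uv -(eqP ru).
case/lastP: u us ru uv => // u r; case/lastP: v vs rv => // v s.
rewrite !size_rcons => -[vs] rvs -[us] rur E.
have [ru dr] := reduced_rcons rur; have [rv ds] := reduced_rcons rvs.
move: ds; rewrite -E; set w := word_perm (rcons u r) in E dr * => ds.
have uE : word_perm u = (transp r * w)%g by rewrite /w word_perm_rcons mul_transpK.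
have vE : word_perm v = (transp s * w)%g by rewrite E word_perm_rcons mul_transpK.
have inv_w : #|inversions w| = k.+1.
  by rewrite -us -(size_rcons u r); apply/esym/eqP.
have [rs|rs] := eqVneq r s.
  by rewrite rs; apply/braid_rcons/IH; rewrite // uE vE rs.
have far_case : (r.+1 < s)%N || (s.+1 < r)%N -> braid_eq (rcons u r) (rcons v s).
  move=> far_rs; have [z zE zs] := exists_word (transp s * (transp r * w)).
  have ds' : descent (transp r * w)%g s.
    by rewrite /descent !permM !transp_id //=; lia.
  have inv_z : (#|inversions w| = (size z).+2)%N.
    by rewrite (inversions_descent dr) (inversions_descent ds') zs.
  have zk : (size z).+1 = k by move: inv_z; rewrite inv_w => -[].
  have zsE : word_perm (rcons z s) = word_perm u.
    by rewrite word_perm_rcons zE mul_transpK uE.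
  have zrE : word_perm (rcons z r) = word_perm v.
    rewrite word_perm_rcons zE vE !mulgA (transp_comm far_rs).
    by rewrite -(mulgA (transp s)) transpK mulg1.
  have uz : braid_eq u (rcons z s).
    by apply: IH; rewrite ?zsE // /reduced zsE size_rcons zk -us.
  have vz : braid_eq v (rcons z r).
    by apply: IH; rewrite ?zrE // /reduced zrE size_rcons zk -vs.
  apply: braid_trans (braid_rcons r uz) _.
  apply: braid_trans (braid_sym (braid_rcons s vz)).
  by rewrite -!cats1 -!catA; apply: braid_comm; rewrite orbC.
have [/far_case//|rs'] := boolP ((r.+1 < s)%N || (s.+1 < r)%N).
have [sr|sr] : s = r.+1 :> nat \/ r = s.+1 :> nat by move: rs; rewrite -val_eqE /=; lia.
  by apply: (@matsumoto_adjacent k) => //; rewrite -?E.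
by apply/braid_sym/(@matsumoto_adjacent k) => //; rewrite -?E.
Qed.

(** The shortest nonreduced prefix [a] of [u] is a reduced word followed by one
    of its right descents [r], and a reduced word can be made to end with any of
    its right descents. *)
Lemma nonreduced_braid u : ~~ reduced u ->
  exists a b z r, u = a ++ b /\ braid_eq a (rcons (rcons z r) r).
Proof.
elim/last_ind: u => [|u r IH].
  by case/negP; rewrite /reduced /= eq_sym -leqn0; exact: (inversions_word [::]).
have [ru|/IH[a [b [z [s [-> h]]]]] _] := boolP (reduced u); last first.
  by exists a, (rcons b r), z, s; rewrite rcons_cat.
rewrite /reduced size_rcons (eqP ru) word_perm_rcons => nr.
have d : descent (word_perm u) r by apply: contraR nr => /inversions_transp->.
have [z zE zs] := exists_word (transp r * word_perm u).
exists (rcons u r), [::], z, r; split; first by rewrite cats0.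
have zrE : word_perm (rcons z r) = word_perm u by rewrite word_perm_rcons zE mul_transpK.
apply/braid_rcons/matsumoto => //; rewrite /reduced zrE size_rcons.
by rewrite (inversions_descent d) zs.
Qed.

End Matsumoto.

(** * Idempotents and dots in an ideal *)

Section BlobLike.

Variables (e l n : nat) (kappa : 'I_l -> 'Z_e) (B : pzRingType).
Variables (psi : 'I_n.-1 -> B) (y : 'I_n -> B) (idem : {ffun 'I_n -> 'Z_e} -> B).
Local Notation residues := {ffun 'I_n -> 'Z_e}.
Implicit Types (i j : residues) (r s : 'I_n.-1) (k p : 'I_n).

Definition braid_unit (a b c : 'Z_e) : B :=
  if (c == a) && (a == b - 1) then -1
  else if (c == a) && (a == b + 1) then 1 else 0.

(** The relations of the blob algebra, over any ring: scalars enter the argument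
    only when spans are formed at the end. *)
Record blob_relations : Prop := {
  br_idemM : forall i j, idem i * idem j = if i == j then idem i else 0;
  br_sum1 : \sum_i idem i = 1;
  br_first : forall i p, p = 0%N :> nat -> (forall m, i p != kappa m) -> idem i = 0;
  br_second : forall i p p' m, p = 0%N :> nat -> p' = 1%N :> nat ->
    i p = kappa m -> i p' = i p + 1 -> idem i = 0;
  br_y1 : forall i p m, p = 0%N :> nat -> i p = kappa m -> y p * idem i = 0;
  br_y_idem : forall i k, y k * idem i = idem i * y k;
  br_psi_idem : forall i r, psi r * idem i = idem (swap_seq r i) * psi r;
  br_psi_y : forall r k, k != fst_pos r -> k != snd_pos r -> psi r * y k = y k * psi r;
  br_psi_psi : forall r s, (r.+1 < s)%N || (s.+1 < r)%N -> psi r * psi s = psi s * psi r;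
  br_psi_ysnd : forall i r, psi r * y (snd_pos r) * idem i =
    y (fst_pos r) * psi r * idem i - (i (fst_pos r) == i (snd_pos r))%:R * idem i;
  br_ysnd_psi : forall i r, y (snd_pos r) * psi r * idem i =
    psi r * y (fst_pos r) * idem i - (i (fst_pos r) == i (snd_pos r))%:R * idem i;
  br_sqr_eq : forall i r, i (fst_pos r) = i (snd_pos r) -> psi r * psi r * idem i = 0;
  br_sqr_far : forall i r, far (i (fst_pos r)) (i (snd_pos r)) ->
    psi r * psi r * idem i = idem i;
  br_sqr_up : forall i r, i (snd_pos r) = i (fst_pos r) + 1 ->
    psi r * psi r * idem i = (y (snd_pos r) - y (fst_pos r)) * idem i;
  br_sqr_down : forall i r, i (snd_pos r) = i (fst_pos r) - 1 ->
    psi r * psi r * idem i = (y (fst_pos r) - y (snd_pos r)) * idem i;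
  br_braid : forall i r s, s = r.+1 :> nat ->
    psi r * psi s * psi r * idem i = psi s * psi r * psi s * idem i
      + braid_unit (i (fst_pos r)) (i (snd_pos r)) (i (snd_pos s)) * idem i
}.

Hypothesis rels : blob_relations.

Lemma idem_psi i r : idem i * psi r = psi r * idem (swap_seq r i).
Proof. by rewrite (br_psi_idem rels) swap_seqK. Qed.

Section Ideal.
Variable K : B -> Prop.

Record ideal : Prop := {
  ideal_0 : K 0;
  ideal_add : forall x z, K x -> K z -> K (x + z);
  ideal_mul : forall a x b, K x -> K (a * x * b)
}.
Hypothesis Kid : ideal.

Lemma ideal_l a x : K x -> K (a * x).
Proof. by move=> Kx; rewrite -[_ * x]mulr1; apply: ideal_mul. Qed.

Lemma ideal_r x b : K x -> K (x * b).
Proof. by move=> Kx; rewrite -[x]mul1r; apply: ideal_mul. Qed.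

Lemma ideal_opp x : K x -> K (- x).
Proof. by rewrite -mulN1r; apply: ideal_l. Qed.

Lemma ideal_sub x z : K x -> K z -> K (x - z).
Proof. by move=> Kx /ideal_opp; apply: ideal_add. Qed.

Definition res_ffun (t : seq 'Z_e) : residues := [ffun k : 'I_n => nth 0 t k].

(** The condition on the size makes sequences of a wrong size harmless, so that
    the rules of [straightening_rules] need no size condition. *)
Definition idem_in (t : seq 'Z_e) : Prop := size t = n -> K (idem (res_ffun t)).
Definition dot_in (q : nat) (t : seq 'Z_e) : Prop :=
  size t = n -> forall k, k = q :> nat -> K (y k * idem (res_ffun t)).

Lemma split_pos (a : seq 'Z_e) x z b : size (a ++ x :: z :: b) = n ->
  exists r : 'I_n.-1, [/\ r = size a :> nat,
    res_ffun (a ++ x :: z :: b) (fst_pos r) = x,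
    res_ffun (a ++ x :: z :: b) (snd_pos r) = z &
    swap_seq r (res_ffun (a ++ x :: z :: b)) = res_ffun (a ++ z :: x :: b)].
Proof.
rewrite size_cat /= => sz; have a_lt : (size a < n.-1)%N by lia.
exists (Ordinal a_lt); have nth_a (u v : 'Z_e) b' : nth 0 (a ++ u :: v :: b') (size a) = u.
  by rewrite nth_cat ltnn subnn.
have nth_a1 (u v : 'Z_e) b' : nth 0 (a ++ u :: v :: b') (size a).+1 = v.
  by rewrite nth_cat ltnNge leqnSn subSnn.
split=> //; rewrite ?ffunE ?nth_a ?nth_a1 //.
apply/ffunP => k; rewrite !ffunE /transp; case: tpermP => [->|->|ka ka1] /=.
- by rewrite nth_a nth_a1.
- by rewrite nth_a nth_a1.
have {}ka : k <> size a :> nat by move=> h; apply: ka; apply: val_inj.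
have {}ka1 : k <> (size a).+1 :> nat by move=> h; apply: ka1; apply: val_inj.
rewrite !nth_cat; case: ltnP => // ak.
by case: (_ - _)%N (subnK ak) => [|[|d]] /= h //; exfalso; lia.
Qed.

Lemma idem_in_far a x z b : far x z -> idem_in (a ++ z :: x :: b) -> idem_in (a ++ x :: z :: b).
Proof.
move=> xz Kzx sz; have [r [rE ix iz sw]] := split_pos sz.
rewrite -(br_sqr_far rels (r := r)) ?ix ?iz //.
rewrite -mulrA (br_psi_idem rels) sw mulrA; apply: ideal_mul Kid _ _ _ _; apply: Kzx.
by move: sz; rewrite !size_cat.
Qed.

Lemma far_neq (x z : 'Z_e) : far x z -> (z == x) = false.
Proof. by rewrite far_sym => /and3P[/negPf]. Qed.

Lemma dot_in_far a x z b : far x z ->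
  dot_in (size a) (a ++ z :: x :: b) -> dot_in (size a).+1 (a ++ x :: z :: b).
Proof.
move=> xz Kzx sz k kE; have [r [rE ix iz sw]] := split_pos sz.
have sz' : size (a ++ z :: x :: b) = n by move: sz; rewrite !size_cat.
have -> : k = snd_pos r by apply: val_inj; rewrite /= kE rE.
rewrite -(br_sqr_far rels (r := r)) ?ix ?iz //.
rewrite -[psi r * psi r * _]mulrA (br_psi_idem rels) sw !mulrA (br_ysnd_psi rels) -sw.
rewrite swap_seq_fst swap_seq_snd ix iz (far_neq xz) mul0r subr0 sw.
by rewrite -(mulrA (psi r)); apply: ideal_mul => //; apply: Kzx => //; rewrite /= rE.
Qed.

(** The nil-Hecke relations give [psi y psi e = psi e] and
    [e = y psi e - psi y' e], where [y], [y'] are the dots on the two equal strands,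
    so that [e] lies in the ideal of [y e]. *)
Lemma idem_in_eq a x b : dot_in (size a) (a ++ x :: x :: b) -> idem_in (a ++ x :: x :: b).
Proof.
move=> Kx sz; have [r [rE ix ix' sw]] := split_pos sz.
set i := res_ffun _ in ix ix' sw *.
have Ky : K (y (fst_pos r) * idem i) by apply: Kx => //=; rewrite rE.
have i_psi : idem i * psi r = psi r * idem i by rewrite idem_psi sw.
have Kpsi : K (psi r * idem i).
  have := br_ysnd_psi rels i r; rewrite ix ix' eqxx mul1r => /(congr1 (fun u => u * psi r)).
  rewrite mulrBl -!mulrA i_psi (mulrA (psi r)) (br_sqr_eq rels) ?ix ?ix' // mulr0.
  move/esym/eqP; rewrite subr_eq0 => /eqP <-.
  by rewrite -i_psi (mulrA (y _)) mulrA; apply: ideal_mul.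
have := br_psi_ysnd rels i r; rewrite ix ix' eqxx mul1r => /esym/eqP.
rewrite subr_eq => /eqP E.
have -> : idem i = y (fst_pos r) * psi r * idem i - psi r * y (snd_pos r) * idem i.
  by rewrite E addrAC subrr add0r.
apply: ideal_sub; first by rewrite -mulrA; apply: ideal_l.
by rewrite -mulrA (br_y_idem rels) mulrA; apply: ideal_r.
Qed.

Lemma dot_in_down a x b : dot_in (size a) (a ++ x :: x - 1 :: b) ->
  idem_in (a ++ x - 1 :: x :: b) -> dot_in (size a).+1 (a ++ x :: x - 1 :: b).
Proof.
move=> Ky Ke sz k kE; have [r [rE ix iz sw]] := split_pos sz.
have -> : k = snd_pos r by apply: val_inj; rewrite /= kE rE.
have := br_sqr_down rels (i := res_ffun (a ++ x :: x - 1 :: b)) (r := r).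
rewrite ix iz => /(_ erefl); rewrite mulrBl => /esym/eqP; rewrite subr_eq => /eqP E.
set i := res_ffun _ in ix iz sw E *.
have -> : y (snd_pos r) * idem i = y (fst_pos r) * idem i - psi r * psi r * idem i.
  by rewrite E addrAC subrr add0r.
apply: ideal_sub; first by apply: Ky => //=; rewrite rE.
rewrite -mulrA (br_psi_idem rels) sw mulrA; apply: ideal_mul => //; apply: Ke.
by move: sz; rewrite !size_cat.
Qed.

(** The error term of the braid relation on [x; x - 1; x] is [e] up to sign, and
    its two main terms factor through the two idempotents of the hypotheses. *)
Lemma idem_in_braid a x b : idem_in (a ++ x :: x :: x - 1 :: b) ->
  idem_in (a ++ x - 1 :: x :: x :: b) -> idem_in (a ++ x :: x - 1 :: x :: b).
Proof.
move=> K1 K2 sz; have [r [rE ix iz sw]] := split_pos sz.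
have sz' : size (rcons a x ++ x - 1 :: x :: b) = n by rewrite cat_rcons.
have [s []] := split_pos sz'; rewrite !cat_rcons size_rcons => sE iz' ix' sw'.
have sr : s = r.+1 :> nat by rewrite sE rE.
set i := res_ffun _ in ix iz ix' sw sw' *.
have Kr : K (psi r * psi s * psi r * idem i).
  rewrite -mulrA (br_psi_idem rels) sw mulrA; apply/ideal_r/ideal_l/K2.
  by move: sz; rewrite !size_cat.
have Ks : K (psi s * psi r * psi s * idem i).
  rewrite -mulrA (br_psi_idem rels) sw' mulrA; apply/ideal_r/ideal_l/K1.
  by move: sz; rewrite !size_cat.
have := br_braid rels i sr; rewrite /braid_unit ix iz ix' eqxx subrK eqxx /= => E.
(* The sign is ambiguous only when 2 = 0 among the residues. *)
have {Ks} : K ((if x == x - 1 - 1 then -1 else 1) * idem i).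
  move: (ideal_sub Kr Ks); rewrite {}E addrAC subrr add0r.
  by rewrite -!iz -!ix.
by case: eqP => _; rewrite ?mul1r // mulN1r => /ideal_opp; rewrite opprK.
Qed.

Lemma idem_in_first (n_gt0 : (0 < n)%N) x b : (forall m, x != kappa m) -> idem_in (x :: b).
Proof.
move=> xk sz; rewrite (br_first rels (p := Ordinal n_gt0)) => [|//|m].
  exact: ideal_0.
by rewrite ffunE.
Qed.

Lemma idem_in_second m b : idem_in (kappa m :: kappa m + 1 :: b).
Proof.
move=> sz; have n_gt1 : (1 < n)%N by rewrite -sz.
rewrite (br_second rels (p := Ordinal (ltnW n_gt1)) (p' := Ordinal n_gt1) (m := m)) ?ffunE //.
exact: ideal_0.
Qed.

Lemma dot_in_first m b : dot_in 0 (kappa m :: b).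
Proof.
by move=> sz k k0; rewrite (br_y1 rels (m := m)) ?ffunE ?k0 //; apply: ideal_0.
Qed.

Lemma idem_in_size t : size t != n -> idem_in t.
Proof. by move/eqP=> h /h. Qed.

(** * Words modulo shorter words *)

Inductive inspan (P : B -> Prop) : B -> Prop :=
| inspan_in x of P x : inspan P x
| inspan_0 : inspan P 0
| inspan_add x z of inspan P x & inspan P z : inspan P (x + z)
| inspan_opp x of inspan P x : inspan P (- x).

Lemma inspan_sub P x z : inspan P x -> inspan P z -> inspan P (x - z).
Proof. by move=> Px Pz; apply/inspan_add/inspan_opp. Qed.

Lemma inspan_map (P Q : B -> Prop) (a b x : B) : (forall z, P z -> inspan Q (a * z * b)) ->
  inspan P x -> inspan Q (a * x * b).
Proof.
move=> PQ; elim=> [z /PQ//||z t _ IHz _ IHt|z _ IH].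
- by rewrite mulr0 mul0r; apply: inspan_0.
- by rewrite mulrDr mulrDl; apply: inspan_add.
by rewrite mulrN mulNr; apply: inspan_opp.
Qed.

Lemma inspan_mulr (P Q : B -> Prop) (b x : B) : (forall z, P z -> inspan Q (z * b)) ->
  inspan P x -> inspan Q (x * b).
Proof.
move=> PQ Px; rewrite -[x]mul1r; apply: inspan_map Px => z /PQ.
by rewrite mul1r.
Qed.

Lemma inspan_bind (P Q : B -> Prop) x : (forall z, P z -> inspan Q z) ->
  inspan P x -> inspan Q x.
Proof.
by move=> PQ Px; rewrite -[x]mulr1; apply: inspan_mulr Px => z /PQ; rewrite mulr1.
Qed.

Definition psi_word (u : seq 'I_n.-1) : B := \prod_(r <- u) psi r.

Lemma psi_word_cat u v : psi_word (u ++ v) = psi_word u * psi_word v.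
Proof. exact: big_cat. Qed.

Lemma psi_word_rcons u r : psi_word (rcons u r) = psi_word u * psi r.
Proof. by rewrite -cats1 psi_word_cat [psi_word [:: r]]big_seq1. Qed.

Lemma psi_word_cons r u : psi_word (r :: u) = psi r * psi_word u.
Proof. exact: big_cons. Qed.

Lemma idem_word i u :
  idem i * psi_word u = psi_word u * idem [ffun k => i (word_perm u k)].
Proof.
elim: u i => [|r u IH] i.
  rewrite /psi_word big_nil mulr1 mul1r; congr idem.
  by apply/ffunP => k; rewrite ffunE /= perm1.
rewrite [psi_word _]big_cons mulrA idem_psi -mulrA IH mulrA; congr (_ * idem _).
by apply/ffunP => k; rewrite !ffunE word_permE.
Qed.

Section Words.

Variable i0 : residues.
Hypothesis K_y : forall k, K (y k * idem i0).
Local Notation e0 := (idem i0).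

(** The filtration of the right ideal of [e0] by the length of words, modulo the
    ideal [K]. *)
Definition short (N : nat) : B -> Prop :=
  inspan (fun x => K x \/ exists2 u, (size u < N)%N & x = e0 * psi_word u).

Lemma short_K N x : K x -> short N x.
Proof. by move=> Kx; apply: inspan_in; left. Qed.

Lemma short_word N u : (size u < N)%N -> short N (e0 * psi_word u).
Proof. by move=> uN; apply: inspan_in; right; exists u. Qed.

Lemma short_leq N M x : (N <= M)%N -> short N x -> short M x.
Proof.
move=> NM; apply: inspan_bind => z [Kz|[u uN ->]]; first exact: short_K.
by apply/short_word/(leq_trans uN).
Qed.

Lemma short_psi_word N x v : short N x -> short (N + size v) (x * psi_word v).
Proof.
apply: inspan_mulr => z [Kz|[u uN ->]]; first exact/short_K/ideal_r.
by rewrite -mulrA -psi_word_cat; apply: short_word; rewrite size_cat ltn_add2r.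
Qed.

Lemma short_psi N x r : short N x -> short N.+1 (x * psi r).
Proof. by move/(short_psi_word [:: r]); rewrite addn1 /psi_word big_seq1. Qed.

Lemma short_idem N x i : short N x -> short N (x * idem i).
Proof.
apply: inspan_mulr => z [Kz|[u uN ->]]; first exact/short_K/ideal_r.
rewrite idem_word -mulrA (br_idemM rels); case: eqP => _; last first.
  by rewrite mulr0; apply: inspan_0.
by rewrite -idem_word; apply: short_word.
Qed.

(** A dot slides through a crossing up to an idempotent; [d] only records the
    sign and the presence of this error term. *)
Lemma idem_psi_y i r k : exists d : bool * bool,
  idem i * psi r * y k = idem i * y (transp r k) * psi r + idem i *+ d.1 - idem i *+ d.2.
Proof.
have i_r : idem i * psi r * y k = psi r * y k * idem (swap_seq r i).
  by rewrite idem_psi -!mulrA (br_y_idem rels).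
have r_i k' : y k' * psi r * idem (swap_seq r i) = idem i * y k' * psi r.
  by rewrite -mulrA -idem_psi mulrA (br_y_idem rels).
have dlt : (i (fst_pos r) == i (snd_pos r))%:R * idem (swap_seq r i) =
    idem i *+ (i (fst_pos r) == i (snd_pos r)).
  by rewrite mulr_natl; case: eqP => [h|//]; rewrite swap_seq_id.
rewrite i_r; have [->|k1] := eqVneq k (fst_pos r).
  exists (i (fst_pos r) == i (snd_pos r), false); rewrite mulr0n subr0 transp_fst -r_i.
  rewrite (br_ysnd_psi rels) swap_seq_fst swap_seq_snd -dlt.
  by rewrite [_ == i (fst_pos r)]eq_sym subrK.
have [->|k2] := eqVneq k (snd_pos r).
  exists (false, i (fst_pos r) == i (snd_pos r)); rewrite mulr0n addr0 transp_snd -r_i.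
  rewrite (br_psi_ysnd rels) swap_seq_fst swap_seq_snd -dlt.
  by rewrite [_ == i (fst_pos r)]eq_sym.
exists (false, false); rewrite mulr0n addr0 subr0 transp_id; first by rewrite (br_psi_y rels).
  by apply: contraNneq k1 => /esym h; apply/eqP/val_inj.
by apply: contraNneq k2 => /esym h; apply/eqP/val_inj.
Qed.

Lemma short_muln N x d : short N x -> short N (x *+ d).
Proof.
move=> sx; elim: d => [|d IH]; first by rewrite mulr0n; apply: inspan_0.
by rewrite mulrS; apply: inspan_add.
Qed.

(** The dot slides to the left until it reaches [e0], where it falls into [K];
    every error term has lost a crossing. *)
Lemma word_y u k : short (size u) (e0 * psi_word u * y k).
Proof.
elim/last_ind: u k => [|u r IH] k.
  by rewrite [psi_word _]big_nil mulr1 -(br_y_idem rels); apply: short_K.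
rewrite size_rcons psi_word_rcons mulrA idem_word.
set i := [ffun _ => _]; rewrite -!mulrA (mulrA (idem i)).
have [d ->] := idem_psi_y i r k; rewrite mulrBr mulrDr !mulrnAr !mulrA -idem_word.
apply: inspan_sub; last by apply/short_muln/short_word.
apply: inspan_add; last by apply/short_muln/short_word.
by apply: short_psi; apply: IH.
Qed.

(** A uniform shape for the quadratic relations; the multiplicities [d] are 0 or
    1 and distinguish the four cases. *)
Lemma psi_sqr i r : exists d : nat * nat * nat,
  idem i * psi r * psi r = idem i *+ d.1.1 + idem i * (y (snd_pos r) - y (fst_pos r)) *+ d.1.2
    - idem i * (y (snd_pos r) - y (fst_pos r)) *+ d.2.
Proof.
have -> : idem i * psi r * psi r = psi r * psi r * idem i.
  by rewrite idem_psi -mulrA idem_psi swap_seqK mulrA.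
have y_i : (y (snd_pos r) - y (fst_pos r)) * idem i = idem i * (y (snd_pos r) - y (fst_pos r)).
  by rewrite mulrBl mulrBr !(br_y_idem rels).
have [far_i|] := boolP (far (i (fst_pos r)) (i (snd_pos r))).
  by exists (1, 0, 0)%N; rewrite (br_sqr_far rels) //= addr0 subr0.
rewrite !negb_and !negbK => /or3P[/eqP h|/eqP h|/eqP h].
- by exists (0, 0, 0)%N; rewrite (br_sqr_eq rels) //= addr0 subr0.
- exists (0, 0, 1)%N; rewrite (br_sqr_down rels) ?h ?addrK //= !add0r mulr1n -y_i.
  by rewrite -mulNr opprB.
exists (0, 1, 0)%N; rewrite (br_sqr_up rels) ?h ?subrK //= subr0 add0r mulr1n.
exact: y_i.
Qed.

(** The error term of the braid relation, seen from the left.  It vanishes unless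
    the outer residues agree, and then the two idempotents at the ends of the
    word are equal. *)
Lemma psi_braid_word i r s : s = r.+1 :> nat -> exists d : bool * bool,
  idem i * (psi r * psi s * psi r - psi s * psi r * psi s) = idem i *+ d.1 - idem i *+ d.2.
Proof.
move=> rs; have [E1 E2] := swap_seq_braid i rs; set j : residues := [ffun _ => _] in E1 E2.
have move3 a b c : idem i * (psi a * psi b * psi c) =
    psi a * psi b * psi c * idem (swap_seq c (swap_seq b (swap_seq a i))).
  by rewrite !mulrA idem_psi -(mulrA _ _ (psi b)) idem_psi -!mulrA idem_psi !mulrA.
rewrite mulrBr !move3 E1 E2 (br_braid rels _ rs) addrAC subrr add0r.
have ji : j (snd_pos s) = j (fst_pos r) -> j = i.
  rewrite !ffunE tpermL tpermR => h; apply/ffunP => k; rewrite ffunE.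
  by case: tpermP => // ->.
rewrite /braid_unit; case: eqP => [/ji ->|_] /=; last by exists (false, false); rewrite mul0r subr0.
case: ifP => _; first by exists (false, true); rewrite mulN1r add0r.
case: ifP => _; first by exists (true, false); rewrite mul1r subr0.
by exists (false, false); rewrite mul0r subr0.
Qed.

Lemma short_braid u v : braid_eq u v -> short (size u) (e0 * psi_word u - e0 * psi_word v).
Proof.
elim=> {u v} [u|u v /braid_size sz IH|u v z /braid_size sz IH1 _ IH2|a r s b rs|a r s b rs].
- by rewrite subrr; apply: inspan_0.
- by rewrite -opprB -sz; apply: inspan_opp.
- by rewrite -[_ - _](subrKA (e0 * psi_word v)); apply: inspan_add; rewrite // sz.
- rewrite !psi_word_cat !psi_word_cons (mulrA (psi r)) (br_psi_psi rels rs) -(mulrA (psi s)).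
  by rewrite subrr; apply: inspan_0.
rewrite !psi_word_cat !psi_word_cons !(mulrA e0) idem_word; set i := [ffun _ => _].
have assoc (x z t : 'I_n.-1) : psi_word a * idem i * (psi x * (psi z * (psi t * psi_word b))) =
    psi_word a * (idem i * (psi x * psi z * psi t)) * psi_word b by rewrite !mulrA.
rewrite !assoc -mulrBl -mulrBr -mulrBr; have [d ->] := psi_braid_word i rs.
rewrite mulrBr !mulrnAr -idem_word mulrBl !mulrnAl -mulrA -psi_word_cat.
have sz : (size (a ++ b) < size (a ++ [:: r, s, r & b]))%N by rewrite !size_cat /=; lia.
by apply: inspan_sub; apply/short_muln/short_word.
Qed.

Lemma short_nonreduced u : ~~ reduced u -> short (size u) (e0 * psi_word u).
Proof.
move=> /nonreduced_braid[a [b [z [r [-> az]]]]].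
rewrite size_cat psi_word_cat mulrA; apply: short_psi_word.
rewrite -[e0 * _](subrK (e0 * psi_word (rcons (rcons z r) r))).
apply: inspan_add; first exact: short_braid.
rewrite (braid_size az) !size_rcons !psi_word_rcons !mulrA idem_word.
set i := [ffun _ => _]; rewrite -!mulrA (mulrA (idem i)).
have [d ->] := psi_sqr i r; set yy := y _ - y _.
rewrite mulrBr mulrDr !mulrnAr !mulrA -idem_word.
have sz : short (size z).+1 (e0 * psi_word z * yy).
  by rewrite mulrBr; apply: inspan_sub; apply: short_leq (word_y _ _).
have zs : (size z < (size z).+2)%N by [].
apply: inspan_sub; last exact/short_muln/(short_leq (leqnSn _)).
by apply: inspan_add; apply: short_muln; [apply: short_word | apply: short_leq sz].
Qed.

Definition inverted (p p' : 'I_n) (w : 'S_n) := ((w^-1)%g p' < (w^-1)%g p)%N.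

(** If [u] puts [p'] before [p], it can be shortened by any right descent other
    than the exchange of [p'] and [p] themselves without losing this property.
    So it suffices to treat the permutations [w] with no other descent, and for
    these the residue sequence at the right end of the word must lie in the
    ideal. *)
Lemma short_inverted (p p' : 'I_n) u :
  (p < p')%N ->
  (forall w : 'S_n, inverted p p' w ->
     (forall r, descent w r -> w (fst_pos r) = p' /\ w (snd_pos r) = p) ->
     K (idem [ffun k => i0 (w k)])) ->
  reduced u -> inverted p p' (word_perm u) -> short (size u) (e0 * psi_word u).
Proof.
move=> pp' Kbase; move: {2}(size u) (erefl (size u)) => N; elim: N u => [|N IH] u uN ru inv_u.
  by move: inv_u; rewrite (size0nil uN) /inverted /= invg1 !perm1; lia.
set w := word_perm u in inv_u.
have [/existsP[r /andP[d ne]]|] :=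
    boolP [exists r, descent w r && ~~ ((w (fst_pos r) == p') && (w (snd_pos r) == p))]; last first.
  move=> /existsPn small; rewrite idem_word; apply/short_K/ideal_l/Kbase => // r d.
  by move: (small r); rewrite d /= negbK => /andP[/eqP-> /eqP->].
have [z zE zs] := exists_word (transp r * w).
have zrE : word_perm (rcons z r) = w by rewrite word_perm_rcons zE mul_transpK.
have rz : reduced (rcons z r) by rewrite /reduced zrE size_rcons (inversions_descent d) zs.
have uz : braid_eq u (rcons z r) by apply: matsumoto; rewrite // zrE.
have zN : size z = N by move: (braid_size uz); rewrite uN size_rcons => -[].
rewrite -[e0 * _](subrK (e0 * psi_word (rcons z r))).
apply: inspan_add; first exact: short_braid.
rewrite (braid_size uz) size_rcons psi_word_rcons mulrA; apply/short_psi/IH => //.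
  by have [] := reduced_rcons rz.
rewrite /inverted zE invMg !permM /transp tpermV.
apply: transp_lt inv_u; apply: contra ne; rewrite xpair_eqE => /andP[/eqP <- /eqP <-].
by rewrite !permKV !eqxx.
Qed.

End Words.

(** * The right ideal of a diagram *)

(** The multicharge extended by 0, since the straightening of residue sequences
    uses natural numbers as indices of components. *)
Definition kap (m : nat) : 'Z_e := oapp kappa 0 (insub m).

Lemma kap_ord (m : 'I_l) : kap m = kappa m.
Proof. by rewrite /kap valK. Qed.

Lemma ideal_rules : (0 < n)%N -> straightening_rules l kap idem_in dot_in.
Proof.
move=> n_gt0; split.
- exact: idem_in_far.
- exact: dot_in_far.
- exact: idem_in_eq.
- exact: dot_in_down.
- exact: idem_in_braid.
- by move=> x b xk; apply: idem_in_first => // m; rewrite -kap_ord; apply: xk.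
- by move=> m b ml; rewrite (kap_ord (Ordinal ml)); apply: idem_in_second.
by move=> m b ml; rewrite (kap_ord (Ordinal ml)); apply: dot_in_first.
Qed.

Section Cell.

Hypothesis l_gt1 : (1 < l)%N.
Hypothesis kappa_far : forall m m' : 'I_l, m != m' -> far (kappa m) (kappa m').
Hypothesis kappa_gap : forall m m' : 'I_l, (m < m')%N -> kappa m != kappa m' + 1 + 1.

Lemma kap_far a b : (a < l)%N -> (b < l)%N -> a != b -> far (kap a) (kap b).
Proof.
by move=> al bl ab; rewrite (kap_ord (Ordinal al)) (kap_ord (Ordinal bl)) kappa_far.
Qed.

Lemma kap_gap a b : (a < b)%N -> (b < l)%N -> kap a != kap b + 1 + 1.
Proof.
move=> ab bl; rewrite (kap_ord (Ordinal (ltn_trans ab bl))) (kap_ord (Ordinal bl)).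
exact: kappa_gap.
Qed.

Local Notation rs := (map (node_res l kap)).

Variable lam : seq nat.
Hypothesis lam_diagram : diagram l lam.
Hypothesis lam_n : size lam = n.
Hypothesis better_K : forall b t, diagram l b -> better b lam -> idem_in (rs b ++ t).

Let i0 := res_ffun (rs lam).

Lemma cell_y k : K (y k * idem i0).
Proof.
have n_gt0 : (0 < n)%N by apply: leq_ltn_trans (ltn_ord k).
have := dot_in_full l_gt1 kap_far kap_gap (ideal_rules n_gt0) lam_diagram better_K (p := k) [::].
by rewrite cats0 lam_n; apply; rewrite ?size_map.
Qed.

Lemma nth_lam_lt (j k : 'I_n) : (nth 0%N lam j < nth 0%N lam k)%N = (j < k)%N.
Proof.
have [lam_s _] := lam_diagram.
have lt (a b : 'I_n) : (a < b)%N -> (nth 0%N lam a < nth 0%N lam b)%N.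
  by move=> ab; apply: (sorted_ltn_nth ltn_trans) => //; rewrite inE lam_n.
have [jk|kj|/val_inj->] := ltngtP j k; first exact: lt; last by rewrite ltnn.
by rewrite ltnNge ltnW // lt.
Qed.

(** A permutation [w] whose only descent exchanges the position [p'] of [c + l] and
    the position [p] of [c]: before the descent the entries increase up to
    [c + l] and avoid [c], after it they increase from [c].  So the entries less
    than [c] all come first, followed by entries between [c] and [c + l], then
    [c + l]; this is the pattern of [idem_in_misplaced]. *)
Lemma cell_single_descent (p p' : 'I_n) (w : 'S_n) :
  nth 0%N lam p' = (nth 0%N lam p + l)%N -> inverted p p' w ->
  (forall r, descent w r -> w (fst_pos r) = p' /\ w (snd_pos r) = p) ->
  K (idem [ffun k => i0 (w k)]).
Proof.
move=> pp' inv_w only.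
set a : 'I_n := (w^-1)%g p'; set b : 'I_n := (w^-1)%g p.
have wa : w a = p' by rewrite permKV.
have wb : w b = p by rewrite permKV.
have p_lt : (p < p')%N by rewrite -nth_lam_lt pp'; lia.
have fst_r r : descent w r -> fst_pos r = a /\ snd_pos r = b.
  by case/only => h h'; rewrite /a /b -h -h' !permK.
have ba : b = a.+1 :> nat.
  have [/existsP[r /fst_r[<- <-]//]|/existsPn nd] := boolP [exists r, descent w r].
  have := incr_of_no_descent (w := w) inv_w (fun r _ => nd r).
  by rewrite -/a -/b wa wb ltnNge ltnW.
have incr_lt (j k : 'I_n) : (j < k)%N -> (k <= a)%N || (b <= j)%N -> (w j < w k)%N.
  move=> jk h; apply: incr_of_no_descent => // r hr; apply/negP => /fst_r[ra rb].
  by have := congr1 val ra; move: hr h => /=; lia.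
pose f (k : 'I_n) := nth 0%N lam (w k); pose s := [seq f k | k <- enum 'I_n].
have s_n : size s = n by rewrite size_map size_enum_ord.
have nth_s (k : 'I_n) : nth 0%N s k = f k.
  by rewrite (nth_map k) ?size_enum_ord // nth_ord_enum.
have -> : [ffun k => i0 (w k)] = res_ffun (rs s).
  by apply/ffunP => k; rewrite !ffunE !(nth_map 0%N) ?lam_n ?s_n ?nth_s.
have f_lt (k k' : 'I_n) : (f k < f k')%N = (w k < w k')%N by rewrite nth_lam_lt.
set c := nth 0%N lam p in pp'.
have fa : f a = (c + l)%N by rewrite /f wa.
have fb : f b = c by rewrite /f wb.
have memA x : x \in take a s -> exists2 k : 'I_n, (k < a)%N & x = f k.
  case/(nthP 0%N) => j; rewrite size_take s_n ltn_ord => ja <-.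
  by exists (Ordinal (ltn_trans ja (ltn_ord a))); rewrite ?nth_take // -nth_s.
have A_sorted : sorted ltn (take a s).
  apply/(sortedP 0%N) => j; rewrite size_take s_n ltn_ord /= => ja.
  have j1n := ltn_trans ja (ltn_ord a).
  rewrite !nth_take //; last exact: ltnW.
  rewrite -[j]/(val (Ordinal (ltnW j1n))) -[(val _).+1]/(val (Ordinal j1n)) !nth_s f_lt.
  by apply: incr_lt; rewrite //= ltnW.
have cA : c \notin take a s.
  apply/negP => /memA[k ka] cE; have kb : k != b by rewrite -val_eqE /= ba; lia.
  have : w k != w b by apply: contra kb => /eqP/perm_inj->.
  by rewrite -val_eqE neq_ltn -!f_lt fb -cE ltnn.
have [lam_s _] := lam_diagram.
have lam_c : lam = take p lam ++ c :: drop p.+1 lam.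
  by rewrite -drop_nth ?cat_take_drop // lam_n.
have low : [seq x <- take a s | (x < c)%N] = take p lam.
  apply: (irr_sorted_eq ltn_trans ltnn); first exact: sorted_filter ltn_trans _ _ A_sorted.
    by apply: take_sorted lam_s.
  move=> x; rewrite mem_filter; apply/andP/idP => [[xc /memA[k _ xE]]|].
    have wk : (w k < p)%N by move: xc; rewrite xE -fb f_lt wb.
    by rewrite xE /f -(nth_take _ wk) mem_nth // size_take lam_n ltn_ord.
  case/(nthP 0%N) => j; rewrite size_take lam_n ltn_ord => jp.
  rewrite nth_take // => <-; have jn := ltn_trans jp (ltn_ord p).
  set k := (w^-1)%g (Ordinal jn).
  have fk : f k = nth 0%N lam j by rewrite /f permKV.
  rewrite -fk; split; first by rewrite -fb f_lt wb permKV.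
  have ka : (k < a)%N.
    rewrite ltnNge leq_eqVlt -ba leq_eqVlt; apply/negP => /or3P[/eqP h|/eqP h|h].
    - by move: wa; rewrite (val_inj h) permKV => /(congr1 val) /=; lia.
    - by move: wb; rewrite (val_inj h) permKV => /(congr1 val) /=; lia.
    by have := incr_lt _ _ h; rewrite leqnn orbT wb permKV /= => /(_ isT); lia.
  by rewrite -nth_s -(nth_take _ ka) mem_nth // size_take s_n ltn_ord.
have sE : s = (take p lam ++ [seq x <- take a s | (c < x)%N]) ++ (c + l)%N :: drop a.+1 s.
  rewrite -low -sorted_split // -fa -nth_s -drop_nth ?cat_take_drop // s_n.
  exact: ltn_ord.
have n_gt0 : (0 < n)%N by apply: leq_ltn_trans (ltn_ord a).
have sz : size (rs s) = n by rewrite size_map.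
move: sz; rewrite {}sE map_cat /= (node_resDl _ l_gt1).
apply: (idem_in_misplaced l_gt1 kap_far kap_gap (ideal_rules n_gt0) lam_diagram better_K _ lam_c).
move=> x; rewrite mem_filter => /andP[-> /memA[k ka ->]] /=.
by rewrite -fa f_lt incr_lt ?leqnn //= ltnW.
Qed.

Variable red : 'S_n -> seq 'I_n.-1.
Hypothesis redP : forall w, word_perm (red w) = w /\ reduced (red w).

(** The permutations [d(t)] of the standard tableaux [t], see
    [standard_of_perm]; it is enough to compare consecutive nodes of a column. *)
Definition standard_perm (w : 'S_n) : Prop := forall p p' : 'I_n,
  nth 0%N lam p' = (nth 0%N lam p + l)%N -> ~~ inverted p p' w.

Definition cell_gen (x : B) : Prop :=
  K x \/ exists2 w, standard_perm w & x = idem i0 * psi_word (red w).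

Lemma cell_of_short N x :
  (forall u, (size u < N)%N -> inspan cell_gen (idem i0 * psi_word u)) ->
  short i0 N x -> inspan cell_gen x.
Proof.
move=> h; apply: inspan_bind => z [Kz|[u uN ->]]; last exact: h.
by apply: inspan_in; left.
Qed.

(** By induction on the length of [u]: words that are not reduced, or whose tableau
    is not standard, become shorter, and the other ones may be replaced with
    the chosen reduced word of the same permutation. *)
Lemma cell_word u : inspan cell_gen (idem i0 * psi_word u).
Proof.
move: {2}(size u).+1 (ltnSn (size u)) => N; elim: N u => // N IH u; rewrite ltnS => uN.
have lower x : short i0 (size u) x -> inspan cell_gen x.
  by apply: cell_of_short => v vu; apply/IH/(leq_trans vu).
have [ru|nr] := boolP (reduced u); last by apply/lower/(short_nonreduced cell_y).
pose w := word_perm u.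
have [/existsP[p /existsP[p' /andP[/eqP pp' inv_w]]]|/existsPn std] := boolP [exists p : 'I_n,
    exists p' : 'I_n, (nth 0 lam p' == nth 0 lam p + l)%N && inverted p p' w].
  apply/lower/(short_inverted _ _ ru inv_w).
    by rewrite -nth_lam_lt pp'; lia.
  by move=> v; apply: cell_single_descent.
have [wE rw] := redP w.
rewrite -[idem i0 * _](subrK (idem i0 * psi_word (red w))).
apply: inspan_add; first by apply/lower/short_braid => //; apply: matsumoto.
apply: inspan_in; right; exists w => // p p' pp'.
by have := std p; rewrite negb_exists => /forallP/(_ p'); rewrite pp' eqxx.
Qed.

Lemma cell_mul_psi x r : inspan cell_gen x -> inspan cell_gen (x * psi r).
Proof.
apply: inspan_mulr => z [Kz|[w _ ->]]; first by apply: inspan_in; left; apply: ideal_r.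
by rewrite -mulrA -psi_word_rcons; apply: cell_word.
Qed.

Lemma cell_mul_y x k : inspan cell_gen x -> inspan cell_gen (x * y k).
Proof.
apply: inspan_mulr => z [Kz|[w _ ->]]; first by apply: inspan_in; left; apply: ideal_r.
by apply: cell_of_short (word_y cell_y _ _) => u _; apply: cell_word.
Qed.

Lemma cell_mul_idem x i : inspan cell_gen x -> inspan cell_gen (x * idem i).
Proof.
apply: inspan_mulr => z [Kz|[w _ ->]]; first by apply: inspan_in; left; apply: ideal_r.
apply: (@cell_of_short (size (red w)).+1) => [u _|]; first exact: cell_word.
by apply/short_idem/short_word.
Qed.

End Cell.
End Ideal.

(** * The largest ideal inside a subspace *)

Section Core.
Variable S : B -> Prop.
Hypothesis S0 : S 0.
Hypothesis SD : forall x z, S x -> S z -> S (x + z).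

Definition core (x : B) : Prop := forall a b, S (a * x * b).

Lemma core_ideal : ideal core.
Proof.
split=> [a b|x z Kx Kz a b|a x b Kx a' b'].
- by rewrite mulr0 mul0r.
- by rewrite mulrDr mulrDl; apply: SD.
by have := Kx (a' * a) (b * b'); rewrite !mulrA.
Qed.

Lemma core_sub x : core x -> S x.
Proof. by move=> Kx; have := Kx 1 1; rewrite mul1r mulr1. Qed.

Variable star : B -> B.
Hypothesis starM : forall a b, star (a * b) = star b * star a.
Hypothesis starK : involutive star.
Hypothesis span_star : forall x, S x -> S (star x).

Lemma core_star x : core x -> core (star x).
Proof.
move=> Kx a b; have := span_star (Kx (star b) (star a)).
by rewrite !starM !starK mulrA.
Qed.

End Core.

End BlobLike.

(** * The blob algebra *)

Section Presentation.
Variables (F : fieldType) (e l n : nat) (kappa : 'I_l -> 'Z_e) (A : algType F).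
Variables (psi : 'I_n.-1 -> A) (y : 'I_n -> A) (idem : {ffun 'I_n -> 'Z_e} -> A).
Local Notation R := (@blob_rel F e l n kappa A psi y idem).
Local Notation pi := (alg_quot_pi R).

Lemma quot_blob_relations : blob_relations kappa (fun r => pi (psi r))
  (fun k => pi (y k)) (fun i => pi (idem i)).
Proof.
have rel u v : R u v -> pi u = pi v by apply: alg_quot_rel.
split.
- move=> i j; have := rel _ _ (rel_orth kappa psi y idem i j).
  by rewrite rmorphM linearZ /= => ->; case: eqP; rewrite ?scale1r ?scale0r.
- by have := rel _ _ (rel_sum1 kappa psi y idem); rewrite raddf_sum rmorph1.
- by move=> i p p0 ip; have := rel _ _ (rel_fst psi y idem p0 ip); rewrite rmorph0.
- move=> i p p' m p0 p1 ip ip'.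
  by have := rel _ _ (rel_snd psi y idem p0 p1 ip ip'); rewrite rmorph0.
- move=> i p m p0 ip.
  by have := rel _ _ (rel_y1 psi y idem p0 ip); rewrite rmorphM rmorph0.
- by move=> i k; apply: qy_idem.
- by move=> i r; apply: qpsi_idem.
- by move=> r k k1 k2; rewrite -!rmorphM; apply/rel/rel_psiy.
- by move=> r s rs; rewrite -!rmorphM; apply/rel/rel_psipsi.
- move=> i r; have := rel _ _ (rel_psiyS kappa psi y idem i r).
  by rewrite !rmorphM rmorphB !rmorphM rmorph_nat mulrBl.
- move=> i r; have := rel _ _ (rel_ySpsi kappa psi y idem i r).
  by rewrite !rmorphM rmorphB !rmorphM rmorph_nat mulrBl.
- move=> i r h; have := rel _ _ (rel_sqr_eq kappa psi y idem h).
  by rewrite rmorphM rmorphXn rmorph0 expr2.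
- move=> i r /and3P[h0 h1 h2]; have := rel _ _ (rel_sqr_far kappa psi y idem h0 h1 h2).
  by rewrite rmorphM rmorphXn expr2.
- move=> i r h; have := rel _ _ (rel_sqr_up kappa psi y idem h).
  by rewrite rmorphM rmorphXn expr2 rmorphM rmorphB.
- move=> i r h; have := rel _ _ (rel_sqr_down kappa psi y idem h).
  by rewrite rmorphM rmorphXn expr2 rmorphM rmorphB.
move=> i r s rs; have := rel _ _ (rel_braid kappa psi y idem i rs).
rewrite /braid_unit /braid_coef; case: ifP => _; [|case: ifP => _];
  by rewrite ?scaleN1r ?scale1r ?scale0r !rmorphM rmorphD ?rmorphN ?rmorph1 ?rmorph0 !rmorphM mulrDl.
Qed.
End Presentation.

Section LinearSpan.
Variables (F : fieldType) (V : lmodType F).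

Inductive linspan (P : V -> Prop) : V -> Prop :=
| linspan_in x of P x : linspan P x
| linspan_0 : linspan P 0
| linspan_add x z of linspan P x & linspan P z : linspan P (x + z)
| linspan_scale c x of linspan P x : linspan P (c *: x).

Lemma linspan_spans P x : linspan P x -> exists2 s : seq (F * V),
  (forall p, p \in s -> P p.2) & x = \sum_(p <- s) p.1 *: p.2.
Proof.
elim=> {x} [x Px||x z _ [s sP ->] _ [s' sP' ->]|c x _ [s sP ->]].
- by exists [:: (1, x)]; [move=> p; rewrite inE => /eqP-> | rewrite big_seq1 scale1r].
- by exists [::]; rewrite ?big_nil.
- exists (s ++ s'); last by rewrite big_cat.
  by move=> p; rewrite mem_cat => /orP[/sP|/sP'].
exists [seq (c * p.1, p.2) | p <- s]; first by move=> _ /mapP[p /sP ? ->].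
by rewrite big_map scaler_sumr; apply: eq_bigr => p _; rewrite scalerA.
Qed.

Lemma linspan_bind (P Q : V -> Prop) (f : V -> V) x :
  f 0 = 0 -> {morph f : u v / u + v} -> (forall c, {morph f : u / c *: u}) ->
  (forall z, P z -> linspan Q (f z)) -> linspan P x -> linspan Q (f x).
Proof.
move=> f0 fD fZ PQ; elim=> [z /PQ//||u v _ Hu _ Hv|c u _ Hu].
- by rewrite f0; apply: linspan_0.
- by rewrite fD; apply: linspan_add.
by rewrite fZ; apply: linspan_scale.
Qed.

End LinearSpan.

Section Blob.
Variables (F : fieldType) (e l n : nat) (kappa : 'I_l -> 'Z_e).
Local Notation B := (blob F n kappa).
Local Notation pi := (alg_quot_pi (@blob_relation F e l n kappa)).

Lemma blob_rels :
  blob_relations kappa (@blob_psi F e l n kappa) (@blob_y F e l n kappa) (@blob_idem F e l n kappa).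
Proof. exact: quot_blob_relations. Qed.

Definition gen_word (v : seq (blob_gen e n)) : B := \prod_(g <- v) pi (free_gen F g).

(** The words in the generators span the algebra. *)
Lemma blob_ind (P : B -> Prop) : P 0 -> (forall x z, P x -> P z -> P (x + z)) ->
  (forall c x, P x -> P (c *: x)) -> (forall v, P (gen_word v)) -> forall x, P x.
Proof.
move=> P0 PD PZ Pw x; rewrite -[x]alg_quot_reprK; move: (alg_quot_repr x) => {x} a.
pose mono w : free_alg F (blob_gen e n) := << w >>.
have -> : a = \sum_(w <- msupp a) a@_w *: mono w by exact: malgU1Z.
have mono_P w : P (pi (a@_w *: mono w)).
  have -> : pi (a@_w *: mono w) = a@_w *: (pi (mono w) : B) by exact: linearZ.
  apply: PZ; case: w => s; rewrite (_ : pi _ = gen_word s) //.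
  elim: s => [|g s IH].
    rewrite /gen_word big_nil -[RHS](rmorph1 pi); congr (pi _); congr << _ >>.
    by apply/eqP; rewrite fmP /= fm1.
  rewrite [RHS]big_cons -/(gen_word s) -IH -[RHS](rmorphM pi); congr (pi _).
  rewrite [RHS]malgUM; congr << _ >>.
  by apply/eqP; rewrite fmP /= fmM fmU.
by rewrite raddf_sum; elim/big_ind: _ => // w _; apply: mono_P.
Qed.

End Blob.

(** * Diagrams and tableaux *)

Section NodeCodes.
Variables (l n : nat).
Hypothesis l_gt0 : (0 < l)%N.

Definition node_code (lam : par1 l n) (x : node lam) : nat := (tagged x * l + tag x)%N.

Lemma node_code_mod (lam : par1 l n) (x : node lam) : (node_code x %% l)%N = tag x.
Proof. by rewrite modnMDl modn_small. Qed.

Lemma node_code_div (lam : par1 l n) (x : node lam) : (node_code x %/ l)%N = tagged x.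
Proof. by rewrite divnMDl // divn_small // addn0. Qed.

Lemma node_code_lt (lam : par1 l n) (x z : node lam) : node_lt x z -> (node_code z < node_code x)%N.
Proof.
rewrite /node_lt /node_row /node_comp /node_code ltnS.
have := ltn_ord (tag x); have := ltn_ord (tag z).
move: (nat_of_ord (tag x)) (nat_of_ord (tag z)) (nat_of_ord (tagged x)) (nat_of_ord (tagged z)).
by move=> a b c d ? ? /orP[?|/andP[/eqP ? ?]]; nia.
Qed.

Definition column_height (a : seq nat) (m : 'I_l) : nat := count (fun c => c %% l == m)%N a.

Lemma column_height_sum (a : seq nat) : size a = n -> (\sum_(m < l) column_height a m)%N = n.
Proof.
move=> <-; elim: a => [|c a IH] /=; first by rewrite big1.
rewrite /column_height /= big_split /= IH -[RHS]add1n; congr (_ + _)%N.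
have cl : (c %% l < l)%N by rewrite ltn_mod.
rewrite (bigD1 (Ordinal cl)) //= eqxx big1 // => m; rewrite -val_eqE /= eq_sym.
by move/negPf->.
Qed.

(** The column of [c] contains the nodes of all the rows above it. *)
Lemma diagram_column (a : seq nat) c : diagram l a -> c \in a ->
  (c %/ l < count (fun d => d %% l == c %% l)%N a)%N.
Proof.
move=> [_ cl] ca; rewrite -size_filter.
pose s := [seq (c %% l + k * l)%N | k <- iota 0 (c %/ l).+1].
have s_uniq : uniq s.
  rewrite map_inj_uniq ?iota_uniq // => i j /eqP; rewrite eqn_add2l eqn_pmul2r //.
  by move/eqP.
have := uniq_leq_size s_uniq (s2 := [seq d <- a | d %% l == c %% l]%N).
rewrite size_map size_iota; apply=> d /mapP[k]; rewrite mem_iota add0n => /= kc ->.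
rewrite mem_filter addnC modnMDl modn_mod eqxx /=.
have -> : k = (c %/ l - (c %/ l - k))%N by lia.
(* Induction on the number [j] of rows above [c]. *)
move: (c %/ l - k)%N (leq_subr k (c %/ l)) => j; elim: j => [|j IH] jc.
  by rewrite subn0 -divn_eq.
have := cl _ (IH (ltnW jc)).
have -> : ((c %/ l - j) * l + c %% l - l = (c %/ l - j.+1) * l + c %% l)%N.
  have -> : (c %/ l - j = (c %/ l - j.+1).+1)%N by lia.
  by rewrite mulSn -addnA addKn.
apply; have -> : (c %/ l - j = (c %/ l - j.+1).+1)%N by lia.
by rewrite mulSn -addnA leq_addr.
Qed.

(** The column heights define the multipartition.  The codes of its nodes
    include [a] by [diagram_column], and there are [n] of them; being increasing,
    the two lists agree. *)
Lemma par1_of_diagram (a : seq nat) : diagram l a -> size a = n ->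
  exists lam : par1 l n, forall k : 'I_n, nth 0%N a k = node_code (initial lam k).
Proof.
move=> a_diag a_n; pose lam := Par1 (column_height_sum a_n); exists lam.
pose s := [seq node_code (initial lam k) | k <- enum 'I_n].
suff -> : a = s by move=> k; rewrite (nth_map k) ?size_enum_ord // nth_ord_enum.
have s_sorted : sorted ltn s.
  rewrite (sorted_pairwise ltn_trans) pairwise_map.
  by apply: sub_pairwise (enum_ord_pairwise n) => j k jk; apply/node_code_lt/initialP.
have [a_sorted _] := a_diag.
apply: (irr_sorted_eq ltn_trans ltnn) => //.
have a_uniq : uniq a by apply: sorted_uniq ltn_trans ltnn _ a_sorted.
have sub : {subset a <= s}.
  move=> c ca; have h := diagram_column a_diag ca.
  have cl : (c %% l < l)%N by rewrite ltn_mod.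
  pose x : node lam := Tagged (fun m => 'I_(lam m)) (Ordinal h : 'I_(lam (Ordinal cl))).
  have [g gK Kg] := tab_bij (initial lam).
  apply/mapP; exists (g x); first by rewrite mem_enum.
  by rewrite Kg /node_code /= -divn_eq.
by have [] := uniq_min_size a_uniq sub; rewrite // size_map size_enum_ord a_n.
Qed.

Lemma initial_residues_code (e : nat) (kappa : 'I_l -> 'Z_e) (lam : par1 l n) (a : seq nat) :
  size a = n -> (forall k : 'I_n, nth 0%N a k = node_code (initial lam k)) ->
  initial_residues lam kappa = res_ffun n [seq node_res l (kap kappa) c | c <- a].
Proof.
move=> a_n aE; apply/ffunP => k; rewrite !ffunE (nth_map 0%N) ?a_n // aE.
rewrite /node_res node_code_mod node_code_div kap_ord /residue /node_row.
by rewrite mulrS opprD addrA addrK.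
Qed.

Lemma standard_of_perm (lam : par1 l n) (a : seq nat) (w : 'S_n) (t : tableau lam) :
  diagram l a -> size a = n -> (forall k : 'I_n, nth 0%N a k = node_code (initial lam k)) ->
  standard_perm l a w -> (forall k, t k = initial lam (w k)) -> standard t.
Proof.
move=> [_ a_cl] a_n aE std tE j k; rewrite /node_row ltnS /node_comp => comp row.
pose f j := node_code (t j).
have fE i : f i = nth 0%N a (w i) by rewrite /f tE aE.
have : exists d, f k = (f j + l * d.+1)%N.
  exists (tagged (t k) - (tagged (t j)).+1)%N; rewrite /f /node_code.
  move: row (congr1 (@nat_of_ord l) comp).
  move: (nat_of_ord (tagged (t j))) (nat_of_ord (tagged (t k))) => x z.
  by move: (nat_of_ord (tag (t j))) (nat_of_ord (tag (t k))) => m m'; nia.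
case=> d; elim: d k {comp row} => [|d IH] k fk.
  have := std (w j) (w k); rewrite -!fE fk muln1 => /(_ erefl).
  rewrite /inverted !permK -leqNgt leq_eqVlt => /orP[/eqP/val_inj jk|//].
  by move: fk; rewrite jk; lia.
have : (f k - l)%N \in a by apply: a_cl; [rewrite fE mem_nth ?a_n | rewrite fk; lia].
case/(nthP 0%N) => p; rewrite a_n => pn ap.
pose k' := (w^-1)%g (Ordinal pn).
have fk' : f k' = (f k - l)%N by rewrite fE permKV.
have jk' : (j < k')%N by apply: IH; rewrite fk' fk; lia.
apply: (ltn_trans jk').
have : f k = (f k' + l)%N by rewrite fk' fk; lia.
rewrite !fE => /std; rewrite /inverted !permK -leqNgt leq_eqVlt => /orP[/eqP/val_inj kk'|//].
by move: fk'; rewrite kk' fk; lia.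
Qed.

End NodeCodes.

(** * Strongly adjacency-free charges *)

Section Charge.
Variables (e l n : nat) (khat : 'I_l -> int).
Hypothesis e_gt1 : (1 < e)%N.
Hypothesis saf : strongly_adjacency_free e n khat.
Local Notation kappa := (charge e khat).

Lemma charge_far (i j : 'I_l) : i != j -> far (kappa i) (kappa j).
Proof.
case/(saf_adj saf) => d0 d1 dN1; rewrite /far -subr_eq0 d0 /=.
by rewrite [kappa j + 1]addrC -subr_eq d1 [kappa j - 1]addrC -subr_eq.
Qed.

Lemma charge_lt (i : 'I_l) : (kappa i < e)%N.
Proof. by rewrite -[X in (_ < X)%N](Zp_cast e_gt1) ltn_ord. Qed.

Lemma charge_eqP (i : 'I_l) (a : nat) : reflect (kappa i = a%:R) (kappa i == a %% e :> nat)%N.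
Proof.
apply: (iffP eqP) => [h|->]; last by rewrite val_Zp_nat.
by apply: val_inj; rewrite /= h -val_Zp_nat.
Qed.

(** As the representatives increase, a residue equation kappa_i = kappa_j + 2
    with [i < j] forces kappa_j - kappa_i = e - 2 for the representatives.  The
    extreme components then differ by e - 2 or e - 1, against the conditions on
    kappa_1 - kappa_l. *)
Lemma charge_gap (i j : 'I_l) : (i < j)%N -> kappa i != kappa j + 1 + 1.
Proof.
move=> ij; apply/negP => /eqP h.
have l_gt1 : (1 < l)%N by have := ltn_ord j; lia.
have shift (k : 'I_l) (a : nat) : kappa k + a%:R = (kappa k + a)%N%:R.
  by rewrite natrD natr_Zp.
have {}h : kappa i = (kappa j + 2)%N%:R by rewrite h -addrA -shift.
pose i0 := Ordinal (ltnW l_gt1); have lastP : (l.-1 < l)%N by lia.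
pose j0 := Ordinal lastP.
have i0_i : (kappa i0 <= kappa i)%N.
  have [->//|ne] := eqVneq i i0; apply/ltnW/(saf_incr saf) => /=.
  by rewrite lt0n; apply: contra ne => /eqP i0E; apply/eqP/val_inj.
have j_j0 : (kappa j <= kappa j0)%N.
  have [->//|ne] := eqVneq j j0; apply/ltnW/(saf_incr saf) => /=.
  have := ltn_ord j; have : (j : nat) != l.-1 by apply: contra ne => /eqP jE; apply/eqP/val_inj.
  by lia.
have ij_lt := saf_incr saf ij.
have := charge_lt j; have := charge_lt j0.
move/charge_eqP/eqP: h.
have [small|big] := ltnP (kappa j + 2) e; first by rewrite modn_small //; lia.
have {1}-> : (kappa j + 2 = (kappa j + 2 - e) + e)%N by rewrite subnK.
rewrite modnDr modn_small => [iE j0_lt j_lt|]; last by have := charge_lt j; lia.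
have [E|NE] := eqVneq (kappa j0 + 2)%N (kappa i0 + e)%N.
  have j0E : j0.+1 = l by exact: prednK (ltnW l_gt1).
  have := saf_ends saf (erefl : i0 = 0%N :> nat) j0E.
  rewrite (shift j0 2) => /eqP; apply; apply/charge_eqP.
  by rewrite E modnDr modn_small // charge_lt.
have ne : i0 != j0 by rewrite -val_eqE /=; lia.
have [_ + _] := saf_adj saf ne; rewrite subr_eq addrC (shift j0 1) => /eqP; apply.
apply/charge_eqP; have -> : (kappa j0 + 1 = kappa i0 + e)%N by lia.
by rewrite modnDr modn_small // charge_lt.
Qed.

End Charge.

(** * The spanning theorem *)

Lemma mul_idempotent (B : pzRingType) (a x b : B) : x * x = x -> a * x * (x * b) = a * x * b.
Proof. by move=> xx; rewrite mulrA -(mulrA a) xx. Qed.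

Section Spanning.
Variables (F : fieldType) (e l n : nat) (kappa : 'I_l -> 'Z_e).
Variable red : 'S_n -> seq 'I_n.-1.
Hypothesis l_gt1 : (1 < l)%N.
Hypothesis kappa_far : forall m m' : 'I_l, m != m' -> far (kappa m) (kappa m').
Hypothesis kappa_gap : forall m m' : 'I_l, (m < m')%N -> kappa m != kappa m' + 1 + 1.
Hypothesis redP : forall w, reduced_expression w (red w).
Local Notation B := (blob F n kappa).
Local Notation star := (@blob_star F e l n kappa).
Local Notation idem := (@blob_idem F e l n kappa).
Local Notation S := (linspan (@C_set F e l n kappa red)).

Lemma mulZl c (x z : B) : (c *: x) * z = c *: (x * z).
Proof. exact/esym/alg_quot_scalerAl. Qed.

Lemma mulZr c (x z : B) : x * (c *: z) = c *: (x * z).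
Proof. exact/esym/alg_quot_scalerAr. Qed.

Lemma starD (x z : B) : star (x + z) = star x + star z.
Proof. by have := blob_star_is_linear 1 x z; rewrite !scale1r. Qed.

Lemma star0 : star 0 = 0.
Proof. by apply: (addrI (star 0)); rewrite -starD !addr0. Qed.

Lemma starZ c (x : B) : star (c *: x) = c *: star x.
Proof. by have := blob_star_is_linear c x 0; rewrite star0 !addr0. Qed.

Lemma star_m_elt (lam : par1 l n) (s t : tableau lam) :
  star (m_elt F kappa red s t) = m_elt F kappa red t s.
Proof. by rewrite /m_elt !blob_starM blob_starK blob_star_idem mulrA. Qed.

Lemma span_star x : S x -> S (star x).
Proof.
apply: linspan_bind; [exact: star0 | exact: starD | exact: starZ | ].
move=> _ [lam [s [t [ss st ->]]]]; rewrite star_m_elt; apply: linspan_in.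
by exists lam, t, s.
Qed.

Local Notation K := (core S).

Lemma span_core_ideal : ideal K.
Proof. by apply: core_ideal; [exact: linspan_0 | exact: linspan_add]. Qed.

Lemma span_of_core x : K x -> S x.
Proof. exact: core_sub. Qed.

Lemma span_core_star x : K x -> K (star x).
Proof. by apply: core_star; [exact: blob_starM | exact: blob_starK | exact: span_star]. Qed.

(** The case of a diagram [a] with [n] nodes.  Every product [b e0 b'] is
    [(e0 b^* )^* (e0 b')], and both [e0 b^*] and [e0 b'] are combinations of
    elements of [K] and of the [e0 psi_d(t)] with [t] standard. *)
Lemma full_in_core (a : seq nat) t : diagram l a -> size a = n ->
  (forall b t', diagram l b -> better b a ->
     idem_in idem K (map (node_res l (kap kappa)) b ++ t')) ->
  idem_in idem K (map (node_res l (kap kappa)) a ++ t).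
Proof.
move=> a_diag a_n better_K; case: t => [|x t]; last first.
  by move=> sz; exfalso; move: sz; rewrite size_cat size_map a_n /=; lia.
rewrite cats0 => _.
have [lam aE] := par1_of_diagram (ltnW l_gt1) a_diag a_n.
rewrite -(initial_residues_code (ltnW l_gt1) kappa a_n aE).
set e0 := idem _.
have redP' w : word_perm (red w) = w /\ reduced (red w) by apply: reduced_expressionP.
have rels := blob_rels F n kappa.
have e0e0 : e0 * e0 = e0 by rewrite (br_idemM (blob_rels _ _ _)) eqxx.
pose half (x : B) := K x \/
  exists2 t : tableau lam, standard t & x = e0 * psi_perm F kappa red (dperm t).
have cell_half x : inspan (cell_gen kappa (@blob_psi F e l n kappa) idem K a red) x -> linspan half x.
  elim=> [z [Kz|[w std ->]]||z z' _ ? _ ?|z _ Hz].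
  - by apply: linspan_in; left.
  - have t_bij : bijective (fun k => initial lam (w k)).
      by apply: bij_comp (tab_bij _) _; exists (w^-1)%g => k; rewrite ?permK ?permKV.
    apply: linspan_in; right; exists (Tableau t_bij).
      exact: (standard_of_perm (ltnW l_gt1) a_diag a_n aE std).
    rewrite -(initial_residues_code (ltnW l_gt1) kappa a_n aE); congr (_ * psi_word _ (red _)).
    apply/permP => k; apply: (bij_inj (tab_bij (initial lam))).
    by rewrite dpermP.
  - exact: linspan_0.
  - exact: linspan_add.
  by rewrite -scaleN1r; apply: linspan_scale.
have e0_half b : linspan half (e0 * b).
  elim/blob_ind: b => [|x z|c x|v].
  - by rewrite mulr0; apply: linspan_0.
  - by rewrite mulrDr; apply: linspan_add.
  - by rewrite mulZr; apply: linspan_scale.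
  apply: cell_half; elim/last_ind: v => [|v g IH].
    rewrite /gen_word big_nil mulr1.
    have := cell_word rels span_core_ideal l_gt1 kappa_far kappa_gap a_diag a_n better_K redP' [::].
    by rewrite /psi_word big_nil mulr1 -(initial_residues_code (ltnW l_gt1) kappa a_n aE).
  rewrite /gen_word -cats1 big_cat big_seq1 /= mulrA.
  case: g => [[r|k]|i].
  - exact: (cell_mul_psi rels span_core_ideal l_gt1 kappa_far kappa_gap a_diag a_n better_K redP').
  - exact: (cell_mul_y rels span_core_ideal l_gt1 kappa_far kappa_gap a_diag a_n better_K redP').
  exact: (cell_mul_idem rels span_core_ideal l_gt1 kappa_far kappa_gap a_diag a_n better_K redP').
have S_half x z : linspan half x -> linspan half z -> S (star x * z).
  move=> hx hz; move: hx; apply: (@linspan_bind _ _ _ _ (fun x => star x * z)).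
  - by rewrite star0 mul0r.
  - by move=> u v; rewrite starD mulrDl.
  - by move=> c u; rewrite starZ mulZl.
  move=> u hu; move: hz; apply: (@linspan_bind _ _ _ _ (fun z => star u * z)).
  - by rewrite mulr0.
  - by move=> v v'; rewrite mulrDr.
  - by move=> c v; rewrite mulZr.
  move=> v; case: hu => [Ku _|[s ss ->]].
    by apply: span_of_core; apply: (ideal_r span_core_ideal); apply: span_core_star.
  case=> [Kv|[t st ->]]; first by apply: span_of_core; apply: (ideal_l span_core_ideal).
  rewrite blob_starM blob_star_idem mul_idempotent //.
  by apply: linspan_in; exists lam, s, t.
move=> b b'.
have -> : b * e0 * b' = star (e0 * star b) * (e0 * b').
  by rewrite blob_starM blob_starK blob_star_idem mul_idempotent.
exact: S_half.
Qed.

Theorem C_set_spans : (0 < n)%N -> spans (@C_set F e l n kappa red).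
Proof.
move=> n_gt0 x; apply: linspan_spans; rewrite -[x]mul1r -[1 * x]mul1r mulrA.
suff K1 : K 1 by exact: K1.
have [K0 KD _] := span_core_ideal.
have sum1 := br_sum1 (blob_rels F n kappa).
suff : K (\sum_i idem i) by rewrite sum1.
apply: (big_ind K K0 KD) => i _.
have -> : i = res_ffun n [seq i k | k <- enum 'I_n].
  by apply/ffunP => k; rewrite ffunE (nth_map k) ?size_enum_ord // nth_ord_enum.
have rules := ideal_rules (blob_rels F n kappa) span_core_ideal n_gt0.
apply: (idem_in_all l_gt1 (kap_far kappa_far) (kap_gap kappa_gap) rules).
- exact: idem_in_size.
- exact: full_in_core.
by rewrite size_map size_enum_ord.
Qed.

End Spanning.

Theorem corollary26 (F : fieldType) (e l n : nat) (q : F)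
    (khat : 'I_l -> int) (red : 'S_n -> seq 'I_n.-1)
    (he : (1 < e)%N) (hl : (1 < l)%N) (hn : (1 < n)%N)
    (hq : e.-primitive_root q) (hq1 : q != 1)
    (hkhat : strongly_adjacency_free e n khat)
    (hred : forall w : 'S_n, reduced_expression w (red w)) :
  spans (@C_set F e l n (charge e khat) red).
Proof.
apply: C_set_spans => //; last exact: ltnW.
- exact: charge_far hkhat.
exact: charge_gap he hkhat.
Qed.
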